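(* Let $\mathcal{H}$ be a complex Hilbert space. An operator $T\in\mathcal{B}(\mathcal{H})$ is a (norm) limit of commutators of orthogonal projections if and only if it satisfies the following three conditions: (a) $T^* = -T$; (b) $\|T\|\le\frac12$; and (c) $T$ is approximately unitarily equivalent to $T^*$.
   Context: $\mathcal{B}(\mathcal{H})$ is the algebra of bounded linear operators on $\mathcal{H}$. An orthogonal projection is $P\in\mathcal{B}(\mathcal{H})$ with $P=P^*=P^2$; a commutator of projections is an operator $PQ-QP$ with $P,Q\in\mathcal{B}(\mathcal{H})$ orthogonal projections. Operators $A,B\in\mathcal{B}(\mathcal{H})$ are approximately unitarily equivalent if there is a sequence $(U_n)_n$ of unitary operators in $\mathcal{B}(\mathcal{H})$ such that $B=\lim_n U_n^*AU_n$ in norm. *)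

(* Defs.v *)
From HB Require Import structures.
From mathcomp Require Import all_boot all_order all_algebra.
From mathcomp Require Import sesquilinear.
From mathcomp Require Import all_classical all_reals all_analysis.
From mathcomp Require Import complex ring lra.

Set Implicit Arguments.
Unset Strict Implicit.
Unset Printing Implicit Defensive.

Import Order.TTheory GRing.Theory Num.Theory.
Import numFieldNormedType.Exports.

Local Open Scope classical_set_scope.
Local Open Scope ring_scope.

(** [inner] is linear in its first argument and conjugate-linear in its second
    one.  *)
HB.mixin Record isHilbert (R : realType) (H : Type)
    & CompleteNormedModule R[i] H := {
  inner : {dot H for @Num.conj R[i]};
  norm_inner : forall x : H, `|x| ^+ 2 = inner x x
}.

#[short(type="hilbertType")]
HB.structure Definition Hilbert (R : realType) :=
  {H of CompleteNormedModule R[i] H & isHilbert R H}.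

#[short(type="boundedOperator")]
HB.structure Definition BoundedOperator (K : numFieldType)
    (H : normedModType K) :=
  {f of @GRing.Linear K H H *:%R f & @isContinuous H H f}.

Notation "''B(' H )" := (boundedOperator H) (format "''B(' H )") : type_scope.

Section BoundedOperatorAlgebra.
Variables (K : numFieldType) (H : normedModType K).
Implicit Types (A B C : 'B(H)) (a b : K).

HB.instance Definition _ := gen_eqMixin 'B(H).
HB.instance Definition _ := gen_choiceMixin 'B(H).

Lemma bopP A B : A =1 B -> A = B.
Proof.
case: A B => [f [[fa] [fs] [fc]]] [g [[ga] [gs] [gc]]]/= /funext fg.
rewrite fg in fa fs fc *.
by rewrite (Prop_irrelevance fa ga) (Prop_irrelevance fs gs)
  (Prop_irrelevance fc gc).
Qed.

Lemma bop_continuous A : continuous A. Proof. exact: cts_fun. Qed.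

Definition bop_pack (f : {linear H -> H}) (fc : continuous f) : 'B(H) :=
  HB.pack (f : H -> H) (GRing.Linear.class f) (isContinuous.Build H H f fc).

Lemma bop_packE (f : {linear H -> H}) (fc : continuous f) :
  bop_pack fc = f :> (H -> H).
Proof. by []. Qed.

Let zero_cont : continuous (\0 : {linear H -> H}).
Proof. by move=> x; exact: cvg_cst. Qed.

Let id_cont : continuous (idfun : {linear H -> H}).
Proof. by move=> x; exact: cvg_id. Qed.

Let opp_cont A : continuous (\- A : {linear H -> H}).
Proof. by move=> x; apply: cvgN; exact: bop_continuous. Qed.

Let add_cont A B : continuous (A \+ B : {linear H -> H}).
Proof. by move=> x; apply: cvgD; exact: bop_continuous. Qed.

Let scale_cont a A : continuous (a \*: A : {linear H -> H}).
Proof. by move=> x; apply: cvgZr; exact: bop_continuous. Qed.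

Let comp_cont A B : continuous (A \o B : {linear H -> H}).
Proof. by move=> x; apply: continuous_comp; exact: bop_continuous. Qed.

Definition bop0 : 'B(H) := bop_pack zero_cont.
Definition bop1 : 'B(H) := bop_pack id_cont.
Definition bopN A : 'B(H) := bop_pack (@opp_cont A).
Definition bopD A B : 'B(H) := bop_pack (@add_cont A B).
Definition bopZ a A : 'B(H) := bop_pack (@scale_cont a A).
Definition bopM A B : 'B(H) := bop_pack (@comp_cont A B).

Let bop_addA : associative bopD.
Proof. by move=> A B C; apply: bopP => x /=; rewrite addrA. Qed.
Let bop_addC : commutative bopD.
Proof. by move=> A B; apply: bopP => x /=; rewrite addrC. Qed.
Let bop_add0 : left_id bop0 bopD.
Proof. by move=> A; apply: bopP => x /=; rewrite add0r. Qed.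
Let bop_addN : left_inverse bop0 bopN bopD.
Proof. by move=> A; apply: bopP => x /=; rewrite addNr. Qed.

HB.instance Definition _ :=
  GRing.isZmodule.Build 'B(H) bop_addA bop_addC bop_add0 bop_addN.

Let bop_mulA : associative bopM.
Proof. by move=> A B C; apply: bopP. Qed.
Let bop_mul1l : left_id bop1 bopM.
Proof. by move=> A; apply: bopP. Qed.
Let bop_mul1r : right_id bop1 bopM.
Proof. by move=> A; apply: bopP. Qed.
Let bop_mulDl : left_distributive bopM +%R.
Proof. by move=> A B C; apply: bopP. Qed.
Let bop_mulDr : right_distributive bopM +%R.
Proof. by move=> A B C; apply: bopP => x /=; rewrite linearD. Qed.

HB.instance Definition _ := GRing.Zmodule_isPzRing.Build 'B(H)
  bop_mulA bop_mul1l bop_mul1r bop_mulDl bop_mulDr.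

Let bop_scaleA a b A : bopZ a (bopZ b A) = bopZ (a * b) A.
Proof. by apply: bopP => x /=; rewrite scalerA. Qed.
Let bop_scale1 : left_id 1 bopZ.
Proof. by move=> A; apply: bopP => x /=; rewrite scale1r. Qed.
Let bop_scaleDr : right_distributive bopZ +%R.
Proof. by move=> a A B; apply: bopP => x /=; rewrite scalerDr. Qed.
Let bop_scaleDl A : {morph bopZ^~ A : a b / a + b}.
Proof. by move=> a b; apply: bopP => x /=; rewrite scalerDl. Qed.

HB.instance Definition _ := GRing.Zmodule_isLmodule.Build K 'B(H)
  bop_scaleA bop_scale1 bop_scaleDr bop_scaleDl.

Lemma bop0E x : (0 : 'B(H)) x = 0. Proof. by []. Qed.
Lemma bop1E x : (1 : 'B(H)) x = x. Proof. by []. Qed.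
Lemma bopNE A x : (- A) x = - A x. Proof. by []. Qed.
Lemma bopDE A B x : (A + B) x = A x + B x. Proof. by []. Qed.
Lemma bopME A B x : (A * B) x = A (B x). Proof. by []. Qed.
Lemma bopZE a A x : (a *: A) x = a *: A x. Proof. by []. Qed.

Lemma bop_bounded A : exists2 M : K, 0 < M & forall x, `|A x| <= M * `|x|.
Proof.
have /linear_boundedP : bounded_near A (nbhs (0 : H)).
  exact/linear_bounded_continuous/bop_continuous.
by move=> /pinfty_ex_gt0[M M0 AM]; exists M.
Qed.

Lemma bounded_bop_continuous (f : {linear H -> H}) (M : K) :
  (forall x, `|f x| <= M * `|x|) -> continuous f.
Proof.
move=> fM; have [|M0] := boolP (M \is Num.real); last first.
  have f0 x : f x = 0.
    have [->|x0] := eqVneq x 0; first exact: linear0.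
    exfalso; move/negP: M0; apply.
    have := le_trans (normr_ge0 _) (fM x).
    by rewrite pmulr_lge0 ?normr_gt0// => /ger0_real.
  move=> x; rewrite (_ : (f : H -> H) = cst 0); last exact/funext.
  exact: cvg_cst.
move=> Mr; apply: bounded_linear_continuous; apply/linear_boundedP.
apply: filterS (nbhs_pinfty_ge Mr) => r Mler x.
by apply: (le_trans (fM x)); rewrite ler_wpM2r.
Qed.

End BoundedOperatorAlgebra.

Section OperatorNorm.
Variables (R : realType) (H : normedModType R[i]).
Implicit Types (A B : 'B(H)) (x : H).

Lemma complex_normE x : `|x| = (complex.Re `|x|)%:C%C.
Proof.
by have := normr_ge0 x; case: `|x| => a b; rewrite lecE/= => /andP[/eqP-> _].
Qed.

(** The norm of a module over [R[i]] takes its values in [R[i]], hence the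
    real part. *)
Definition opnorm A : R :=
  sup [set complex.Re `|A x| | x in [set x | `|x| <= 1]].

Let opnorm_set_has_sup A :
  has_sup [set complex.Re `|A x| | x in [set x | `|x| <= 1]].
Proof.
split; first by exists (complex.Re `|A 0|), 0 => //=; rewrite normr0 ler01.
have [M M0 AM] := bop_bounded A.
exists (complex.Re M) => _ [x /= x1 <-].
have : `|A x| <= M.
  by apply: (le_trans (AM x)); rewrite -[leRHS]mulr1 ler_pM2l.
by rewrite lecE => /andP[].
Qed.

Lemma opnorm_ub A x : `|x| <= 1 -> `|A x| <= (opnorm A)%:C%C.
Proof.
move=> x1; rewrite complex_normE lecR.
by apply: sup_upper_bound; [exact: opnorm_set_has_sup|exists x].
Qed.

Lemma opnorm_le A (M : R) :
  (forall x, `|x| <= 1 -> `|A x| <= M%:C%C) -> opnorm A <= M.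
Proof.
move=> AM; apply: ge_sup; first by case: (opnorm_set_has_sup A).
by move=> _ [x /= x1 <-]; have := AM x x1; rewrite {1}complex_normE lecR.
Qed.

Lemma opnorm_ge0 A : 0 <= opnorm A.
Proof.
rewrite -ler0c; apply: le_trans (opnorm_ub (x := 0) A _) => //.
by rewrite normr0 ler01.
Qed.

Let bop_norm A : R[i] := (opnorm A)%:C%C.

Lemma bop_norm_ge0 A : 0 <= bop_norm A.
Proof. by rewrite ler0c opnorm_ge0. Qed.

Lemma bop_norm_ub A x : `|A x| <= bop_norm A * `|x|.
Proof.
have [->|x0] := eqVneq x 0; first by rewrite linear0 !normr0 mulr0.
have n0 : 0 < `|x| by rewrite normr_gt0.
rewrite -ler_pdivrMr//.
rewrite -[X in _ / X]normr_id mulrC -normfV -normrZ -linearZ.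
by apply: opnorm_ub; rewrite normrZ normfV normr_id mulVf// gt_eqF.
Qed.

Let bop_normD A B : bop_norm (A + B) <= bop_norm A + bop_norm B.
Proof.
rewrite /bop_norm -rmorphD lecR; apply: opnorm_le => x x1.
rewrite bopDE rmorphD/= (le_trans (ler_normD _ _))//.
by rewrite lerD// opnorm_ub.
Qed.

Let bop_norm_leZ (a : R[i]) A : bop_norm (a *: A) <= `|a| * bop_norm A.
Proof.
have aE : `|a| = (complex.Re `|a|)%:C%C by case: a.
rewrite aE /bop_norm -rmorphM lecR; apply: opnorm_le => x x1.
by rewrite bopZE normrZ rmorphM/= -aE ler_wpM2l// opnorm_ub.
Qed.

Let bop_norm0_eq0 A : bop_norm A = 0 -> A = 0.
Proof.
move=> A0; apply: bopP => x; apply/eqP.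
by have := bop_norm_ub A x; rewrite A0 mul0r normr_le0.
Qed.

Let bop_normZ (a : R[i]) A : bop_norm (a *: A) = `|a| * bop_norm A.
Proof.
apply/eqP; rewrite eq_le bop_norm_leZ/=.
have [->|a0] := eqVneq a 0; first by rewrite normr0 mul0r bop_norm_ge0.
rewrite -ler_pdivlMl ?normr_gt0// -normfV.
by rewrite -{1}[A](scalerK a0) bop_norm_leZ.
Qed.

HB.instance Definition _ :=
  Lmodule_isNormed.Build R[i] 'B(H) bop_normD bop_normZ bop_norm0_eq0.

Lemma bop_normE A : `|A| = (opnorm A)%:C%C. Proof. by []. Qed.

End OperatorNorm.

Section HilbertTheory.
Variables (R : realType) (H : hilbertType R).
Implicit Types (x y z h : H).

Local Notation "''[' x , y ]" := (inner x%R y%R) : ring_scope.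

Lemma innerDl x y z : '[x + y, z] = '[x, z] + '[y, z].
Proof. exact: linearDl. Qed.
Lemma innerDr x y z : '[z, x + y] = '[z, x] + '[z, y].
Proof. exact: linearDr. Qed.
Lemma innerZl a x y : '[a *: x, y] = a * '[x, y].
Proof. exact: linearZl_LR. Qed.
Lemma innerZr a x y : '[x, a *: y] = a^* * '[x, y].
Proof. by rewrite linearZr_LR. Qed.
Lemma innerNl x y : '[- x, y] = - '[x, y].
Proof. exact: linearNl. Qed.
Lemma innerNr x y : '[x, - y] = - '[x, y].
Proof. exact: linearNr. Qed.
Lemma innerBl x y z : '[x - y, z] = '[x, z] - '[y, z].
Proof. by rewrite innerDl innerNl. Qed.
Lemma innerBr x y z : '[z, x - y] = '[z, x] - '[z, y].
Proof. by rewrite innerDr innerNr. Qed.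
Lemma inner0l x : '[0, x] = 0. Proof. exact: linear0l. Qed.
Lemma inner0r x : '[x, 0] = 0. Proof. exact: linear0r. Qed.
Lemma innerC x y : '[x, y] = '[y, x]^*.
Proof. by rewrite (hermC inner) expr0 mul1r. Qed.
Lemma inner_eq0 x : '[x, x] = 0 -> x = 0.
Proof. by move=> /eqP; rewrite -norm_inner sqrf_eq0 normr_eq0 => /eqP. Qed.

Lemma inner_injr y z : (forall x, '[x, y] = '[x, z]) -> y = z.
Proof.
move=> yz; apply/eqP; rewrite -subr_eq0; apply/eqP; apply: inner_eq0.
by rewrite innerBr yz subrr.
Qed.

Lemma pythagoras x y : '[x, y] = 0 -> `|x + y| ^+ 2 = `|x| ^+ 2 + `|y| ^+ 2.
Proof.
move=> xy; rewrite !norm_inner innerDl !innerDr xy.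
by rewrite [in '[y, x]]innerC xy rmorph0 addr0 add0r.
Qed.

Lemma cauchy_schwarz x y : `|'[x, y]| <= `|x| * `|y|.
Proof.
have [->|y0] := eqVneq y 0; first by rewrite inner0r !normr0 mulr0.
have n0 : 0 < `|y| by rewrite normr_gt0.
have nn0 : '[y, y] != 0 by rewrite -norm_inner sqrf_eq0 gt_eqF.
pose a := '[x, y] / '[y, y].
have u0 : '[x - a *: y, a *: y] = 0.
  by rewrite innerZr innerBl innerZl divfK// subrr mulr0.
have := pythagoras u0; rewrite subrK => xE.
have : `|a *: y| <= `|x|.
  by rewrite -(@ler_pXn2r _ 2)// ?nnegrE// xE lerDr exprn_ge0.
have -> : `|a *: y| = `|'[x, y]| / `|y|.
  rewrite normrZ normrM normfV -norm_inner normrX normr_id expr2 invfM.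
  by rewrite mulrA -[LHS]mulrA mulVf ?mulr1// gt_eqF.
by rewrite ler_pdivrMr.
Qed.

Lemma parallelogram x y :
  `|x + y| ^+ 2 + `|x - y| ^+ 2 = `|x| ^+ 2 *+ 2 + `|y| ^+ 2 *+ 2.
Proof.
rewrite !norm_inner !innerDl !innerDr !innerNl !innerNr.
by ring.
Qed.

(** Riesz representation: the representing vector is a multiple of a vector of
    minimal norm in the hyperplane [f = 1]. *)
Section Riesz.
Variables (f : H -> R[i]) (M : R[i]).
Hypothesis fD : forall x y, f (x + y) = f x + f y.
Hypothesis fZ : forall a x, f (a *: x) = a * f x.
Hypothesis fM : forall x, `|f x| <= M * `|x|.

Let nr x : R := complex.Re `|x|.
Let nrE x : `|x| = (nr x)%:C%C. Proof. exact: complex_normE. Qed.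
Let nr_ge0 x : 0 <= nr x. Proof. by rewrite -ler0c -nrE. Qed.
Let fB x y : f (x - y) = f x - f y.
Proof. by rewrite fD -scaleN1r fZ mulN1r. Qed.

Lemma riesz_min : (exists x, f x = 1) ->
  exists2 x0, f x0 = 1 & forall x, f x = 1 -> `|x0| <= `|x|.
Proof.
move=> [e fe].
pose S := [set nr x | x in [set x | f x = 1]].
have Sinf : has_inf S.
  by split; [exists (nr e), e | exists 0 => _ [x _ <-]].
pose d := inf S.
have dle x : f x = 1 -> d <= nr x by move=> fx; apply: ge_inf => //; [case: Sinf|exists x].
have d0 : 0 <= d by apply: lb_le_inf => [|_ [x _ <-]//]; case: Sinf.
have app n : exists x, f x = 1 /\ nr x < d + n.+1%:R^-1.
  have [|_ [x fx <-] xd] := @inf_adherent _ S n.+1%:R^-1 _ Sinf.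
    by rewrite invr_gt0.
  by exists x.
have [u ux] := choice app.
have half x y : f x = 1 -> f y = 1 -> d *+ 2 <= nr (x + y).
  move=> fx fy; have /dle : f (2^-1 *: (x + y)) = 1.
    by rewrite fZ fD fx fy mulVf// pnatr_eq0.
  suff -> : nr (2^-1 *: (x + y)) = nr (x + y) / 2 by lra.
  apply: complexI; rewrite -nrE normrZ normfV ger0_norm// nrE mulrC.
  by rewrite rmorphM fmorphV rmorph_nat.
have close x y (c : R) : 0 <= c -> f x = 1 -> f y = 1 ->
    nr x < d + c -> nr y < d + c -> nr (x - y) ^+ 2 <= 4 * (d *+ 2 + c) * c.
  move=> c0 fx fy xd yd.
  have := parallelogram x y; rewrite !nrE -!rmorphXn -!rmorphMn -!rmorphD.
  move=> /complexI pE.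
  have := half x y fx fy => xyd.
  have : (d *+ 2) ^+ 2 <= nr (x + y) ^+ 2.
    by rewrite ler_pXn2r ?nnegrE ?mulrn_wge0.
  have : nr x ^+ 2 <= (d + c) ^+ 2.
    by rewrite ler_pXn2r ?nnegrE ?addr_ge0// ltW.
  have : nr y ^+ 2 <= (d + c) ^+ 2.
    by rewrite ler_pXn2r ?nnegrE ?addr_ge0// ltW.
  by move: pE; nra.
have uclose m n : (m <= n)%N ->
    nr (u m - u n) ^+ 2 <= 4 * (d *+ 2 + 1) * m.+1%:R^-1.
  move=> mn; have [fm um] := ux m; have [fn un] := ux n.
  have c0 : 0 <= m.+1%:R^-1 :> R by rewrite invr_ge0.
  apply: le_trans (close _ _ _ c0 fm fn um _) _.
    apply: (lt_le_trans un); rewrite lerD2l lef_pV2 ?posrE ?ltr0n//.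
    by rewrite ler_nat.
  rewrite ler_wpM2r// ler_wpM2l// lerD2l invf_le1 ?ltr0n//.
  by rewrite ler1n.
have real_gt0 (e' : R[i]) : 0 < e' -> exists2 r : R, 0 < r & e' = r%:C%C.
  by case: e' => a b; rewrite ltcE/= => /andP[/eqP-> a0]; exists a.
have small (r : R) : 0 < r -> exists n : nat, n.+1%:R^-1 < r.
  move=> r0; have [n rn] := ltr_add_invr r0.
  by exists n; rewrite add0r in rn.
have ucvg : cvg (u @ \oo).
  apply: cauchy_cvg; apply: cauchy_exP => _ /real_gt0[r r0 ->].
  pose c := r ^+ 2 / (4 * (d *+ 2 + 1)).
  have D0 : 0 < 4 * (d *+ 2 + 1).
    by rewrite mulr_gt0// ltr_wpDl// mulrn_wge0.
  have [N Nc] := small c (divr_gt0 (exprn_gt0 2 r0) D0).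
  exists (u N); exists N => // n /= Nn; rewrite -ball_normE/= nrE ltcR.
  rewrite -(@ltr_pXn2r _ 2) ?nnegrE// ?ltW//.
  by rewrite (le_lt_trans (uclose _ _ Nn))// mulrC -ltr_pdivlMr.
have [l ul] := (cvg_ex _).1 ucvg.
have {}ul (r : R) : 0 < r -> exists n : nat, nr (l - u n) < r /\ n.+1%:R^-1 < r.
  move=> r0; have r0' : 0 < r%:C%C :> R[i] by rewrite (ltcR 0).
  have [N _ uN] := proj1 (@cvgrPdist_lt _ _ _ _ _ _ _) ul _ r0'.
  have [m mr] := small r r0.
  exists (maxn N m); split.
    by have := uN (maxn N m) (leq_maxl _ _); rewrite /= nrE ltcR.
  rewrite (le_lt_trans _ mr)// lef_pV2 ?posrE ?ltr0n// ler_nat ltnS.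
  exact: leq_maxr.
exists l.
  apply/eqP; rewrite -subr_eq0 -normr_eq0; apply/eqP.
  have [//|/eqP p0] := pselect (`|f l - 1| = 0).
  have {p0} : 0 < `|f l - 1| by rewrite lt_def p0 normr_ge0.
  pose L := complex.Re `|M|.
  have LE : `|M| = L%:C%C by rewrite /L; case: (M).
  have L0 : 0 <= L by rewrite -ler0c -LE.
  move=> p0; have [p pr pE] := real_gt0 _ p0.
  have L1 : 0 < L + 1 by rewrite ltr_wpDl.
  have [n [ln _]] := ul _ (divr_gt0 pr L1).
  have := fM (l - u n); rewrite fB (proj1 (ux n)) => H1.
  have := ger0_norm (le_trans (normr_ge0 _) H1).
  rewrite normrM normr_id LE => H2; move: H1; rewrite -H2 pE nrE -rmorphM lecR.
  move: ln; rewrite ltr_pdivlMr// => H3 H4.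
  by exfalso; have := nr_ge0 (l - u n); nra.
move=> x /dle dx; rewrite !nrE lecR (le_trans _ dx)//.
apply/ler_addgt0Pr => r r0; have [n [ln nn]] := ul _ (divr_gt0 r0 (ltr0n _ 2)).
have [_ un] := ux n.
have : nr l <= nr (l - u n) + nr (u n).
  by rewrite -lecR rmorphD/= -!nrE -{1}[l](subrK (u n)) ler_normD.
by move: ln nn un; set q := n.+1%:R^-1; lra.
Qed.

Lemma riesz : exists z, forall x, f x = '[x, z].
Proof.
have [f0|] := pselect (forall x, f x = 0).
  by exists 0 => x; rewrite f0 inner0r.
move=> /existsNP[v /eqP fv0].
have [|x0 fx0 x0min] := riesz_min.
  by exists ((f v)^-1 *: v); rewrite fZ mulVf.
have orth h : f h = 0 -> '[h, x0] = 0.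
  move=> fh; have [->|h0] := eqVneq h 0; first by rewrite inner0l.
  have hh0 : '[h, h] != 0.
    by apply: contra_neq h0; exact: inner_eq0.
  pose t := '[x0, h] / '[h, h].
  have u0 : '[x0 - t *: h, t *: h] = 0.
    by rewrite innerZr innerBl innerZl divfK// subrr mulr0.
  have := pythagoras u0; rewrite subrK => xE.
  have : `|x0| <= `|x0 - t *: h| by apply: x0min; rewrite fB fZ fh mulr0 subr0.
  rewrite -(@ler_pXn2r _ 2) ?nnegrE// xE gerDl => th.
  have : t *: h = 0.
    by apply/eqP; rewrite -normr_eq0 -sqrf_eq0 eq_le th exprn_ge0.
  move=> /eqP; rewrite scaler_eq0 (negbTE h0) orbF mulf_eq0 invr_eq0.
  by rewrite (negbTE hh0) orbF => /eqP x0h; rewrite innerC x0h rmorph0.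
have x00 : '[x0, x0] != 0.
  apply/eqP => /inner_eq0 x00; have := fx0.
  rewrite x00 -(scale0r (0 : H)) fZ mul0r => /eqP.
  by rewrite eq_sym oner_eq0.
exists (('[x0, x0])^-1^* *: x0) => x.
rewrite innerZr conjCK.
have /orth : f (x - f x *: x0) = 0 by rewrite fB fZ fx0 mulr1 subrr.
by rewrite innerBl innerZl => /subr0_eq ->; rewrite mulrC mulfK.
Qed.
End Riesz.

Lemma adjoint_exists (A : 'B(H)) :
  exists B : 'B(H), forall x y, '[A x, y] = '[x, B y].
Proof.
have [M M0 AM] := bop_bounded A.
have ex y : exists z, forall x, '[A x, y] = '[x, z].
  apply: (@riesz (fun x => '[A x, y]) (M * `|y|)) => [x x'|a x|x].
  - by rewrite linearD innerDl.
  - by rewrite linearZ innerZl.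
  - rewrite (le_trans (cauchy_schwarz _ _))// mulrAC ler_wpM2r//.
have [g gE] := choice ex.
have g_lin : linear g.
  move=> a y z; apply: inner_injr => x.
  by rewrite -gE !innerDr !innerZr -!gE.
pose G : {linear H -> H} := HB.pack g (GRing.isLinear.Build _ _ _ _ g g_lin).
have G_cont : continuous G.
  apply: (@bounded_bop_continuous _ _ G M) => y.
  have [->|g0] := eqVneq (G y) 0; first by rewrite normr0 mulr_ge0// ltW.
  have n0 : 0 < `|G y| by rewrite normr_gt0.
  rewrite -(ler_pM2l n0) -expr2 norm_inner -gE.
  have := ger0_norm (exprn_ge0 2 (normr_ge0 (G y))).
  rewrite norm_inner -gE => <-.
  rewrite (le_trans (cauchy_schwarz _ _))// mulrA ler_wpM2r// mulrC.
  exact: AM.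
by exists (bop_pack G_cont) => x y; rewrite gE.
Qed.

Definition adjoint (A : 'B(H)) : 'B(H) := projT1 (cid (adjoint_exists A)).

Lemma adjointE (A : 'B(H)) x y : '[A x, y] = '[x, adjoint A y].
Proof. by rewrite /adjoint; case: cid. Qed.

Lemma adjoint_unique (A B : 'B(H)) :
  (forall x y, '[A x, y] = '[x, B y]) -> adjoint A = B.
Proof.
by move=> AB; apply: bopP => y; apply: inner_injr => x; rewrite -adjointE.
Qed.

End HilbertTheory.

Section OperatorNotions.
Variables (R : realType) (H : hilbertType R).
Implicit Types A B P U : 'B(H).

Definition orthogonal_projection P := P = adjoint P /\ P = P * P.

Definition commutator_of_projections A := exists P Q : 'B(H),
  [/\ orthogonal_projection P, orthogonal_projection Q & A = P * Q - Q * P].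

Definition unitary U := adjoint U * U = 1 /\ U * adjoint U = 1.

(** [-->] in ['B(H)] is convergence in operator norm. *)
Definition approx_unitarily_equivalent A B := exists U : nat -> 'B(H),
  (forall n, unitary (U n)) /\ adjoint (U n) * A * U n @[n --> \oo] --> B.

Definition limit_of_projection_commutators A := exists C : nat -> 'B(H),
  (forall n, commutator_of_projections (C n)) /\ C n @[n --> \oo] --> A.

End OperatorNotions.

(* Main.v *)
Require Import Defs.
From HB Require Import structures.
From mathcomp Require Import all_boot all_order all_algebra.
From mathcomp Require Import all_classical all_reals all_analysis.
From mathcomp Require Import complex ring lra.

Set Implicit Arguments.
Unset Strict Implicit.
Unset Printing Implicit Defensive.

Import Order.TTheory GRing.Theory Num.Theory.
Import numFieldNormedType.Exports.

Local Open Scope classical_set_scope.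
Local Open Scope ring_scope.

(** A commutator of projections is a commutator of symmetries: if [s = 2 P - 1]
    and [t = 2 Q - 1], then [4 (P Q - Q P) = s t - t s].  This gives at once that
    the commutator [C] is skew-adjoint, that its norm is at most [1/2], and that
    [s C s = - C = C^*] with [s] unitary.  The three properties pass to limits,
    the last one as an approximate equivalence.

    Conversely, a skew-adjoint [T] of norm at most [1/2] that anticommutes with
    some symmetry [s] is itself a commutator
    ([commutator_of_anticommuting]): with [r] the square root of [1 + 4 T ^ 2],
    the operator [t = s r + 2 s T] is a symmetry and [s t - t s = 4 T].  For an
    arbitrary symmetry [s], the operator [(T - s T s) / 2] anticommutes with [s],
    so it is enough to find, for every [e > 0], a projection [F] such that [F T F]
    and [(1 - F) T (1 - F)] have norm at most [e], and to take [s = 2 F - 1].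

    Let [A = i T], which is self-adjoint, with positive and negative parts [p] and
    [q].  The hypothesis provides unitaries [U] with [A U + U A] as small as
    desired.  Then [`|A|] almost commutes with [U], because it is a limit of
    polynomials in [A ^ 2] at a rate independent of [A] ([absolute_value]), and
    [p U - U q] is small.  Hence the self-adjoint operator
    [K = p U q + q U^* p] almost anticommutes with [A], and [K ^ 2] is close to
    [p ^ 4 + q ^ 4 = A ^ 4] ([almost_anticommuting]).  Let [F] be the projection
    onto the kernel of [`|K| + K], so that [K] is [- `|K|] on the range of [F] and
    [`|K|] on its orthogonal ([sign_decomposition]).  The compression [a] of [A]
    to either part almost anticommutes with the positive operator [`|K|].  On an
    eigenvector [x] of [a ^ 2] for an eigenvalue [l ^ 2 > 0], exact
    anticommutation would give
    [l ^ 2 <`|K| x, x> + <`|K| a x, a x> = 0], so [K x = 0], so [A ^ 2 x = 0] and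
    [a x = 0], which is absurd; approximate eigenvectors turn this into a bound on
    the norm of [a] ([compression_small]).  The jump of the
    sign of [K] at [0] does no harm: where [K] is small, [A] is small too. *)

(** * Real-valued norms *)

Section RealNorm.
Variables (R : realType) (V : normedModType R[i]).
Implicit Types x y : V.

(** The norms of [R[i]]-modules are complex numbers; their real parts allow
    reasoning in the ordered field [R]. *)
Definition rnorm x : R := complex.Re `|x|.

Lemma rnormE x : `|x| = (rnorm x)%:C%C.
Proof. exact: complex_normE. Qed.

Lemma rnorm_ge0 x : 0 <= rnorm x.
Proof. by rewrite -ler0c -rnormE. Qed.

Lemma rnormD x y : rnorm (x + y) <= rnorm x + rnorm y.
Proof. by rewrite -lecR rmorphD/= -!rnormE ler_normD. Qed.

Lemma rnormN x : rnorm (- x) = rnorm x.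
Proof. by rewrite /rnorm normrN. Qed.

Lemma rnormB x y : rnorm (x - y) <= rnorm x + rnorm y.
Proof. by rewrite -(rnormN y) rnormD. Qed.

Lemma rnorm_distC x y : rnorm (x - y) = rnorm (y - x).
Proof. by rewrite /rnorm distrC. Qed.

Lemma rnorm0 : rnorm (0 : V) = 0.
Proof. by rewrite /rnorm normr0. Qed.

Lemma rnorm_eq0 x : rnorm x = 0 -> x = 0.
Proof. by move=> x0; apply/eqP; rewrite -normr_eq0 rnormE x0. Qed.

Lemma rnormZ (a : R) x : 0 <= a -> rnorm (a%:C%C *: x) = a * rnorm x.
Proof.
move=> a0; apply: complexI; rewrite -rnormE normrZ rmorphM/= -rnormE.
by congr (_ * _); rewrite ger0_norm// ler0c.
Qed.

Lemma rnormVn (n : nat) x : rnorm (n%:R^-1 *: x) = n%:R^-1 * rnorm x.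
Proof.
rewrite -rnormZ ?invr_ge0//; congr (rnorm (_ *: _)).
by rewrite fmorphV rmorph_nat.
Qed.

Lemma rnorm_arbitrarily_small x : (forall e : R, 0 < e -> rnorm x <= e) -> x = 0.
Proof.
move=> xe; apply: rnorm_eq0; apply/eqP; rewrite eq_le rnorm_ge0 andbT.
by apply/ler_addgt0Pr => e e0; rewrite add0r xe.
Qed.

Lemma cvg_rnormP (u : nat -> V) (l : V) :
  (u n @[n --> \oo] --> l) <->
  (forall e : R, 0 < e -> exists N, forall n, (N <= n)%N -> rnorm (u n - l) <= e).
Proof.
split=> [ul e e0|ul].
  have e0' : 0 < e%:C%C :> R[i] by rewrite (ltcR 0).
  have [N _ uN] := proj1 (@cvgrPdist_le _ _ _ _ _ _ _) ul _ e0'.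
  exists N => n Nn; have := uN n Nn.
  by rewrite /= rnormE lecR rnorm_distC.
apply/cvgrPdist_le => e; case: e => a b; rewrite ltcE/= => /andP[/eqP-> a0].
have [N uN] := ul a a0; exists N => // n /= Nn.
by rewrite rnormE lecR rnorm_distC uN.
Qed.

End RealNorm.

(** * The algebra of operators *)

Section OperatorEvaluation.
Variables (R : realType) (H : hilbertType R).
Implicit Types (A B C : 'B(H)) (x y : H).

Lemma addopE A B x : (A + B) x = A x + B x. Proof. by []. Qed.
Lemma oppopE A x : (- A) x = - A x. Proof. by []. Qed.
Lemma scaleopE (a : R[i]) A x : (a *: A) x = a *: A x. Proof. by []. Qed.
Lemma mulopE A B x : (A * B) x = A (B x). Proof. by []. Qed.
Lemma oneopE x : (1 : 'B(H)) x = x. Proof. by []. Qed.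
Lemma opD A x y : A (x + y) = A x + A y. Proof. exact: linearD. Qed.
Lemma opN A x : A (- x) = - A x. Proof. exact: linearN. Qed.
Lemma opZ A (a : R[i]) x : A (a *: x) = a *: A x. Proof. exact: linearZ. Qed.
Lemma op0 A : A 0 = 0. Proof. exact: linear0. Qed.

Lemma bop_inner_ext A B : (forall x y, inner (A x) y = inner (B x) y) -> A = B.
Proof.
move=> AB; apply: bopP => x; apply: inner_injr => y.
by rewrite innerC AB -innerC.
Qed.

End OperatorEvaluation.

(** Identities in the noncommutative algebra of operators reduce to identities
    between complex numbers by testing them on vectors: the values of the words
    become atoms. *)
Ltac bop_ring :=
  apply: bop_inner_ext => ? ?;
  repeat match goal with
  | |- context [@BoundedOperator.sort _ _ (@GRing.mul _ ?A ?B) ?x] =>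
      rewrite (mulopE A B x)
  | |- context [@BoundedOperator.sort _ _ (@Algebra.add _ ?A ?B) ?x] =>
      rewrite (addopE A B x)
  | |- context [@BoundedOperator.sort _ _ (@Algebra.opp _ ?A) ?x] =>
      rewrite (oppopE A x)
  | |- context [@BoundedOperator.sort _ _ (@GRing.scale _ _ ?a ?A) ?x] =>
      rewrite (scaleopE a A x)
  | |- context [@BoundedOperator.sort _ _ (@GRing.one _) ?x] =>
      rewrite (oneopE x)
  end;
  rewrite ?(opD, opZ, opN);
  rewrite ?(innerDl, innerNl, innerZl);
  repeat match goal with
  | |- context [inner ?u ?v] => generalize (inner u v); intro
  end;
  first [ring | field; rewrite ?pnatr_eq0 //].

Section OperatorAlgebra.
Variables (R : realType) (H : hilbertType R).
Implicit Types (A B C : 'B(H)) (x y : H).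

Lemma rnorm_bop A x : rnorm (A x) <= rnorm A * rnorm x.
Proof. by rewrite -lecR rmorphM/= -!rnormE; exact: bop_norm_ub. Qed.

Lemma rnorm_bop_le A (M : R) :
  (forall x, rnorm (A x) <= M * rnorm x) -> 0 <= M -> rnorm A <= M.
Proof.
move=> AM M0; apply: opnorm_le => x; rewrite !rnormE !lecR => x1.
by rewrite (le_trans (AM x))// ler_piMr.
Qed.

Lemma rnormM A B : rnorm (A * B) <= rnorm A * rnorm B.
Proof.
apply: rnorm_bop_le => [x|]; last by rewrite mulr_ge0 ?rnorm_ge0.
rewrite bopME -mulrA (le_trans (rnorm_bop _ _))//.
by rewrite ler_wpM2l ?rnorm_ge0// rnorm_bop.
Qed.

Lemma adjointD A B : adjoint (A + B) = adjoint A + adjoint B.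
Proof.
by apply: adjoint_unique => x y; rewrite !bopDE innerDl innerDr !adjointE.
Qed.

Lemma adjointZ (a : R[i]) A : adjoint (a *: A) = a^* *: adjoint A.
Proof.
by apply: adjoint_unique => x y; rewrite !bopZE innerZl innerZr conjCK adjointE.
Qed.

Lemma adjointN A : adjoint (- A) = - adjoint A.
Proof. by apply: adjoint_unique => x y; rewrite !bopNE innerNl innerNr adjointE. Qed.

Lemma adjointM A B : adjoint (A * B) = adjoint B * adjoint A.
Proof. by apply: adjoint_unique => x y; rewrite !bopME !adjointE. Qed.

Lemma adjoint1 : adjoint (1 : 'B(H)) = 1.
Proof. exact: adjoint_unique. Qed.

Lemma adjointK : involutive (@adjoint R H).
Proof.
by move=> A; apply: adjoint_unique => x y; rewrite innerC -adjointE -innerC.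
Qed.

Lemma rnorm_sqr x : (rnorm x ^+ 2)%:C%C = inner x x.
Proof. by rewrite -norm_inner rnormE rmorphXn. Qed.

Lemma Re_inner_le x y : complex.Re (inner x y) <= rnorm x * rnorm y.
Proof.
rewrite -lecR rmorphM/= -!rnormE; apply: le_trans (cauchy_schwarz x y).
case: (inner x y) => a b /=; rewrite normc_def lecR/=.
by rewrite (le_trans (ler_norm _))// -sqrtr_sqr ler_wsqrtr// lerDl sqr_ge0.
Qed.

Lemma rnorm_adjoint A : rnorm (adjoint A) <= rnorm A.
Proof.
apply: rnorm_bop_le (rnorm_ge0 _) => y.
have [->|/eqP y0] := pselect (rnorm (adjoint A y) = 0).
  by rewrite mulr_ge0 ?rnorm_ge0.
have {y0}y0 : 0 < rnorm (adjoint A y) by rewrite lt_neqAle eq_sym y0 rnorm_ge0.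
have h1 : rnorm (adjoint A y) ^+ 2 <= rnorm (A (adjoint A y)) * rnorm y.
  rewrite (le_trans _ (Re_inner_le _ _))// adjointE -rnorm_sqr//.
have h2 := rnorm_bop A (adjoint A y); have h3 := rnorm_ge0 y.
by rewrite -(ler_pM2l y0); nra.
Qed.

End OperatorAlgebra.

(** * Completeness *)

Section Completeness.
Variables (R : realType) (H : hilbertType R).

Lemma hilbert_complete (u : nat -> H) :
  (forall d : R, 0 < d -> exists n, forall m, (n <= m)%N -> rnorm (u m - u n) <= d) ->
  exists l : H, u n @[n --> \oo] --> l.
Proof.
move=> ucauchy; suff : cvg (u n @[n --> \oo]) by exact: (cvg_ex _).1.
apply: cauchy_cvg; apply: cauchy_exP => -[a b].
rewrite ltcE/= => /andP[/eqP-> a0].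
have [n nd] := ucauchy _ (divr_gt0 a0 (ltr0n _ 2)).
exists (u n); exists n => // m /= /nd umn.
by rewrite -ball_normE/= rnormE ltcR rnorm_distC (le_lt_trans umn)//; lra.
Qed.

(** A special case of the Banach-Steinhaus theorem, with the uniform bound
    given in advance. *)
Lemma pointwise_limit (Y : nat -> 'B(H)) (M : R) :
  (forall n, rnorm (Y n) <= M) ->
  (forall x, exists l : H, Y n x @[n --> \oo] --> l) ->
  exists L : 'B(H), forall x, Y n x @[n --> \oo] --> L x.
Proof.
move=> YM /choice[f fE].
have f_lin : linear f.
  move=> a x y; apply: (@cvg_unique _ _ _ _ _ _ (fE _)).
    exact: norm_hausdorff.
  rewrite (_ : (fun n => _) = (fun n => a *: Y n x + Y n y)).
    by apply: cvgD; [apply: cvgZr; exact: fE | exact: fE].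
  by apply/funext => n; rewrite opD opZ.
pose F : {linear H -> H} := HB.pack f (GRing.isLinear.Build _ _ _ _ f f_lin).
have F_cont : continuous F.
  apply: (@bounded_bop_continuous _ _ F M%:C%C) => x.
  rewrite !rnormE -rmorphM lecR; apply/ler_addgt0Pr => d d0.
  have [N Nd] := (cvg_rnormP _ _).1 (fE x) d d0.
  rewrite -(subrK (Y N x) (F x)) (le_trans (rnormD _ _))// addrC lerD//.
    by rewrite (le_trans (rnorm_bop _ _))// ler_wpM2r ?rnorm_ge0.
  by rewrite rnorm_distC Nd.
by exists (bop_pack F_cont).
Qed.

Lemma bop_complete (Y : nat -> 'B(H)) (e : nat -> R) :
  (forall n m, (n <= m)%N -> rnorm (Y m - Y n) <= e n) ->
  (forall d, 0 < d -> exists n, e n <= d) ->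
  exists L, forall n, rnorm (L - Y n) <= e n.
Proof.
move=> Ye e0.
have ge0 n : 0 <= e n by apply: le_trans (Ye n n _); rewrite ?rnorm_ge0.
have Yx n m x : (n <= m)%N -> rnorm (Y m x - Y n x) <= e n * rnorm x.
  move=> /Ye nm; rewrite (_ : Y m x - Y n x = (Y m - Y n) x)//.
  by rewrite (le_trans (rnorm_bop _ _))// ler_wpM2r// rnorm_ge0.
have [||L LE] := @pointwise_limit Y (e 0%N + rnorm (Y 0%N)).
- by move=> n; rewrite -[Y n](subrK (Y 0%N)) (le_trans (rnormD _ _))// lerD// Ye.
- move=> x; apply: hilbert_complete => d d0.
  have x1 : 0 < rnorm x + 1 by rewrite ltr_wpDl ?rnorm_ge0.
  have [n nd] := e0 _ (divr_gt0 d0 x1).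
  exists n => m /Yx => /(_ x)/le_trans; apply.
  move: nd; rewrite ler_pdivlMr//.
  by have := ge0 n; have := rnorm_ge0 x; nra.
exists L => n; apply: rnorm_bop_le => // x.
apply/ler_addgt0Pr => d d0; have [N Nd] := (cvg_rnormP _ _).1 (LE x) d d0.
have h1 := Nd (maxn N n) (leq_maxl _ _).
have h2 := Yx _ _ x (leq_maxr N n).
rewrite (_ : (L - Y n) x = (Y (maxn N n) x - Y n x) - (Y (maxn N n) x - L x)).
  by rewrite (le_trans (rnormB _ _))// lerD.
by rewrite opprB [RHS]addrC subrKA.
Qed.

End Completeness.

(** * Square roots of positive operators *)

Section SquareRoot.
Variables (R : realType) (H : hilbertType R).
Implicit Types (A B S U : 'B(H)).

Definition positive S := forall x, 0 <= inner (S x) x.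

Lemma inner_selfadjoint_real A x : adjoint A = A -> inner (A x) x \is Num.real.
Proof. by move=> sA; apply/CrealP; rewrite -innerC adjointE sA. Qed.

Lemma positive_1B A : adjoint A = A -> rnorm A <= 1 -> positive (1 - A).
Proof.
move=> sA A1 x; rewrite addopE oppopE oneopE innerDl innerNl subr_ge0.
apply: (le_trans (real_ler_norm (inner_selfadjoint_real x sA))).
rewrite (le_trans (cauchy_schwarz _ _))// -norm_inner expr2 ler_wpM2r//.
by rewrite !rnormE lecR (le_trans (rnorm_bop _ _))// ler_piMl ?rnorm_ge0.
Qed.

(** Picard iteration for [L = (B + L ^ 2) / 2], that is, for
    [(1 - L) ^ 2 = 1 - B]. *)
Definition sqrt_iter B n : 'B(H) := iter n (fun Y => 2^-1 *: (B + Y * Y)) 0.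

(** The case [B = 1] of the iteration; its limit is [1]. *)
Definition sqrt_iter1 n : R := iter n (fun t => 2^-1 * (1 + t * t)) 0.

Lemma sqrt_iter1_ge0 n : 0 <= sqrt_iter1 n.
Proof.
elim: n => //= n IH; rewrite -/(sqrt_iter1 n).
by rewrite mulr_ge0 ?invr_ge0// addr_ge0 ?mulr_ge0.
Qed.

(** The errors satisfy [z' = z - z ^ 2 / 2], which has the supersolution
    [2 / (n + 2)]. *)
Lemma sqrt_iter1_le n : 0 <= 1 - sqrt_iter1 n <= 2 / n.+2%:R.
Proof.
elim: n => [|n]; first by rewrite subr0 divff ?pnatr_eq0// ler01 lexx.
have := sqrt_iter1_ge0 n.
have -> : sqrt_iter1 n.+1 = 2^-1 * (1 + sqrt_iter1 n * sqrt_iter1 n) by [].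
set y := sqrt_iter1 n => y0 /andP[y1 yn].
have k2 : 2 <= n.+2%:R :> R by rewrite ler_nat.
rewrite -[n.+3%:R]natr1; move: k2 yn; set k := n.+2%:R => k2 yn.
have c1 : 2 / k <= 1 by rewrite ler_pdivrMr; lra.
have -> : 2 / (k + 1) = 2 / k - 2^-1 * (2 / k) ^+ 2 + 2 / (k ^+ 2 * (k + 1)).
  by field; apply/andP; split; apply: lt0r_neq0; lra.
have : 0 <= 2 / (k ^+ 2 * (k + 1)).
  by rewrite divr_ge0// mulr_ge0 ?exprn_ge0//; lra.
move: yn c1; set c := 2 / k; set r := 2 / _ => yn c1 r0.
by apply/andP; split; nra.
Qed.

Lemma sqrt_iter1_cvg (d : R) : 0 < d -> exists n, 1 - sqrt_iter1 n <= d.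
Proof.
move=> d0; have [n nd] := ltr_add_invr (divr_gt0 d0 (ltr0n R 2)).
exists n; have /andP[_ /le_trans->//] := sqrt_iter1_le n.
move: nd; rewrite add0r ltr_pdivlMr// mulrC => /ltW; apply: le_trans.
by rewrite ler_pM2l// lef_pV2 ?posrE ?ltr0n// ler_nat.
Qed.

(** Comparison with the scalar iteration: the terms of the iteration are
    polynomials with nonnegative coefficients in [B], and so are their
    differences. *)
Lemma sqrt_iter_lip B n m : rnorm B <= 1 -> (n <= m)%N ->
  rnorm (sqrt_iter B m - sqrt_iter B n) <= sqrt_iter1 m - sqrt_iter1 n.
Proof.
move=> B1.
have Yy k : rnorm (sqrt_iter B k) <= sqrt_iter1 k.
  elim: k => [|k IH]; first by rewrite rnorm0.
  rewrite [sqrt_iter B _]/= [sqrt_iter1 _]/= -/(sqrt_iter B k) -/(sqrt_iter1 k).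
  rewrite rnormVn ler_pM2l ?invr_gt0// (le_trans (rnormD _ _))// lerD//.
  by rewrite (le_trans (rnormM _ _))// ler_pM ?rnorm_ge0.
elim: n m => [m _|n IH [//|m]]; first by rewrite !subr0.
rewrite ltnS => nm.
rewrite [sqrt_iter B m.+1]/= [sqrt_iter1 m.+1]/= [sqrt_iter B n.+1]/=.
rewrite [sqrt_iter1 n.+1]/= -!/(sqrt_iter _ _) -!/(sqrt_iter1 _).
have := IH m nm; have := Yy n; have := Yy m.
set Y := sqrt_iter B m; set Z := sqrt_iter B n; set y := sqrt_iter1 m.
set z := sqrt_iter1 n => Yy1 Zz YZ.
have -> : 2^-1 *: (B + Y * Y) - 2^-1 *: (B + Z * Z)
    = 2^-1 *: (Y * (Y - Z) + (Y - Z) * Z) :> 'B(H) by bop_ring.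
have -> : 2^-1 * (1 + y * y) - 2^-1 * (1 + z * z)
    = 2^-1 * (y * (y - z) + (y - z) * z) by field.
rewrite rnormVn ler_pM2l ?invr_gt0// (le_trans (rnormD _ _))//.
by apply: lerD; apply: le_trans (rnormM _ _) _; apply: ler_pM; rewrite ?rnorm_ge0.
Qed.

Lemma sqrt_iter_comm B U n : rnorm B <= 1 ->
  rnorm (sqrt_iter B n * U - U * sqrt_iter B n)
    <= n%:R * rnorm (B * U - U * B).
Proof.
move=> B1; elim: n => [|n].
  by rewrite mul0r mulr0 subr0 rnorm0 mul0r.
have : rnorm (sqrt_iter B n) <= 1.
  have := sqrt_iter_lip B1 (leq0n n); rewrite !subr0 => /le_trans; apply.
  by have /andP[+ _] := sqrt_iter1_le n; rewrite subr_ge0.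
rewrite [sqrt_iter B n.+1]/= -!/(sqrt_iter _ _); set Y := sqrt_iter B n => Y1 IH.
have -> : (2^-1 *: (B + Y * Y)) * U - U * (2^-1 *: (B + Y * Y))
  = 2^-1 *: ((B * U - U * B) + (Y * (Y * U - U * Y) + (Y * U - U * Y) * Y)).
  by bop_ring.
rewrite rnormVn -[n.+1%:R]natr1 (mulrDl n%:R) mul1r; move: IH.
set b := rnorm (B * U - U * B); set D := Y * U - U * Y => IH.
have h1 := rnormD (B * U - U * B) (Y * D + D * Y).
have h2 := rnormD (Y * D) (D * Y).
have h3 := rnormM Y D; have h4 := rnormM D Y; have h5 := rnorm_ge0 D.
have h6 := rnorm_ge0 Y; have h7 : 0 <= b := rnorm_ge0 _.
by rewrite ler_pdivrMl//; rewrite -/b in h1; nra.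
Qed.

(** The square root of [1 - B] is [1 - L], where [L] solves
    [L = (B + L ^ 2) / 2].  It is approximated by polynomials in [B] at a rate
    that does not depend on [B]; hence an operator that almost commutes with
    [B] almost commutes with the root. *)
Lemma sqrt_one_minus B : adjoint B = B -> rnorm B <= 1 ->
  exists S, [/\ adjoint S = S, positive S, S * S = 1 - B &
    forall e, 0 < e -> exists n : nat, forall U,
      rnorm (S * U - U * S) <= e * rnorm U + n%:R * rnorm (B * U - U * B)].
Proof.
move=> sB B1; pose Y := sqrt_iter B; pose e n := 1 - sqrt_iter1 n.
have Ye n m : (n <= m)%N -> rnorm (Y m - Y n) <= e n.
  move=> nm; rewrite (le_trans (sqrt_iter_lip B1 nm))// lerD2r.
  by have /andP[+ _] := sqrt_iter1_le m; rewrite subr_ge0.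
have [L LY] := bop_complete Ye sqrt_iter1_cvg.
(* the error bounds [e n] tend to 0 *)
have small (A : 'B(H)) (c : R) : 0 < c ->
    (forall n, rnorm A <= c * e n) -> A = 0.
  move=> c0 Ac; apply: rnorm_arbitrarily_small => d d0.
  have [n nd] := sqrt_iter1_cvg (divr_gt0 d0 c0).
  by rewrite (le_trans (Ac n))// mulrC -ler_pdivlMr.
have L1 : rnorm L <= 1.
  by have := LY 0%N; rewrite /e /Y /= !subr0.
have Y1 n : rnorm (Y n) <= 1.
  rewrite -[Y n](subr0); apply: le_trans (Ye 0%N n _) _ => //.
  by rewrite /e /= subr0.
have sY n : adjoint (Y n) = Y n.
  elim: n => [|n IH]; first by rewrite /Y /= -(scale0r 0) adjointZ rmorph0 !scale0r.
  rewrite [Y _]/= -/(sqrt_iter _ _) -/(Y n) adjointZ adjointD adjointM IH sB.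
  by rewrite fmorphV rmorph_nat.
have e_mono n : e n.+1 <= e n.
  rewrite lerB// /= -/(sqrt_iter1 n).
  by have /andP[] := sqrt_iter1_le n; have := sqrt_iter1_ge0 n; nra.
have e2 n : 2 * e n = e n + e n by ring.
have sL : adjoint L = L.
  apply/eqP; rewrite -subr_eq0; apply/eqP; apply: (small _ 2) => // n.
  rewrite -[X in rnorm X](subrKA (Y n)) e2.
  rewrite (le_trans (rnormD _ _))// lerD//; last by rewrite rnorm_distC.
  by rewrite -{1}(sY n) -adjointN -adjointD (le_trans (rnorm_adjoint _)).
have LE : L = 2^-1 *: (B + L * L).
  apply/eqP; rewrite -subr_eq0; apply/eqP; apply: (small _ 2) => // n.
  have -> : L - 2^-1 *: (B + L * L) = (L - Y n.+1)
      - 2^-1 *: (L * (L - Y n) + (L - Y n) * Y n).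
    by rewrite [Y n.+1]/= -/(sqrt_iter _ _) -/(Y n); bop_ring.
  rewrite e2 (le_trans (rnormB _ _))// lerD//.
    by rewrite (le_trans (LY _)).
  rewrite rnormVn ler_pdivrMl// e2.
  rewrite (le_trans (rnormD _ _))// lerD// (le_trans (rnormM _ _))//.
    by rewrite -[leRHS]mul1r ler_pM ?rnorm_ge0.
  by rewrite -[leRHS]mulr1 ler_pM ?rnorm_ge0.
exists (1 - L); split.
- by rewrite adjointD adjointN adjoint1 sL.
- exact: positive_1B.
- have -> : (1 - L) * (1 - L) = 1 - 2 *: L + L * L by bop_ring.
  by rewrite {1}LE; bop_ring.
move=> d d0; have [n nd] := sqrt_iter1_cvg (divr_gt0 d0 (ltr0n R 2)).
exists n => U; have h1 := @sqrt_iter_comm B U n B1; rewrite -/(Y n) in h1.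
have -> : (1 - L) * U - U * (1 - L)
  = (U * (L - Y n) - (L - Y n) * U) - (Y n * U - U * Y n) by bop_ring.
have h2 := rnormB (U * (L - Y n) - (L - Y n) * U) (Y n * U - U * Y n).
have h3 := rnormB (U * (L - Y n)) ((L - Y n) * U).
have h4 := rnormM U (L - Y n); have h5 := rnormM (L - Y n) U.
have h6 := LY n; rewrite -/(e n) in nd; have h7 := rnorm_ge0 U.
have h8 : d / 2 * 2 = d by field.
by nra.
Qed.

End SquareRoot.

(** * Absolute values and projections onto kernels *)

Section AbsoluteValue.
Variables (R : realType) (H : hilbertType R).
Implicit Types (A B K N P S U : 'B(H)) (x y : H).

Lemma rnorm_sqr_selfadjoint A x : adjoint A = A ->
  (rnorm (A x) ^+ 2)%:C%C = inner (A (A x)) x.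
Proof. by move=> sA; rewrite rnorm_sqr -{2}sA -adjointE. Qed.

Lemma eq_rnorm_sqr A B x : adjoint A = A -> adjoint B = B -> A * A = B * B ->
  rnorm (A x) = rnorm (B x).
Proof.
move=> sA sB AB; apply/eqP; rewrite -(@eqrXn2 _ 2)// ?rnorm_ge0//; apply/eqP.
by apply: complexI; rewrite !rnorm_sqr_selfadjoint// -!mulopE AB.
Qed.

Lemma rnorm_sqrB x y (c : R) : inner x y = c%:C%C ->
  rnorm (x - y) ^+ 2 = rnorm x ^+ 2 - 2 * c + rnorm y ^+ 2.
Proof.
move=> xyc; apply: complexI; rewrite rmorphD rmorphB /= !rnorm_sqr rmorphM.
rewrite !innerDl !innerDr !innerNl !innerNr (innerC y) xyc.
rewrite (_ : (c%:C%C)^* = c%:C%C); last by apply/CrealP/complex_realP; exists c.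
by rewrite rmorph_nat; ring.
Qed.

Lemma rnorm_1B_sqr A : adjoint A = A -> rnorm A <= 1 -> rnorm (1 - A * A) <= 1.
Proof.
move=> sA A1; apply: rnorm_bop_le => // x; rewrite mul1r.
rewrite addopE oppopE oneopE mulopE.
have xAAx : inner x (A (A x)) = (rnorm (A x) ^+ 2)%:C%C.
  by rewrite -{1}sA -adjointE rnorm_sqr.
rewrite -(@ler_pXn2r _ 2) ?nnegrE ?rnorm_ge0// (rnorm_sqrB xAAx).
have : rnorm (A (A x)) <= rnorm (A x).
  by rewrite (le_trans (rnorm_bop _ _))// ler_piMl ?rnorm_ge0.
by have := rnorm_ge0 (A x); have := rnorm_ge0 (A (A x)); nra.
Qed.

(** The last clause is a form of the norm continuity of the absolute value: an
    operator that almost commutes with [A ^ 2] almost commutes with the absolute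
    value of [A]. *)
Lemma absolute_value A : adjoint A = A -> rnorm A <= 1 ->
  exists P, [/\ adjoint P = P, positive P, P * P = A * A &
    forall e, 0 < e -> exists n : nat, forall U,
      rnorm (P * U - U * P)
        <= e * rnorm U + n%:R * rnorm (A * A * U - U * (A * A))].
Proof.
move=> sA A1; have sB : adjoint (1 - A * A) = 1 - A * A.
  by rewrite adjointD adjointN adjoint1 adjointM sA.
have [P [sP P0 PP Pcomm]] := sqrt_one_minus sB (rnorm_1B_sqr sA A1).
exists P; split=> //; first by rewrite PP opprB addrC subrK.
move=> e /Pcomm[n nU]; exists n => U; rewrite (le_trans (nU U))//.
rewrite (_ : (1 - A * A) * U - _ = - (A * A * U - U * (A * A))) ?rnormN//.
by bop_ring.
Qed.

(** With [Z] the square root of [1 - N ^ 2], the projection is the strong limit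
    of the powers [Z ^ 2n].  They converge because the inner product of
    [Z ^ 2m x] and [Z ^ 2n x] is [`|Z ^ (m + n) x| ^ 2], and these numbers
    decrease with [m + n].  The limit is fixed by [Z ^ 2 = 1 - N ^ 2], so its
    values lie in the kernel of [N]. *)
Lemma kernel_projection N : adjoint N = N -> rnorm N <= 1 ->
  exists F, [/\ orthogonal_projection F, N * F = 0 &
    forall x, N x = 0 -> F x = x].
Proof.
move=> sN N1; have sNN : adjoint (N * N) = N * N by rewrite adjointM sN.
have NN1 : rnorm (N * N) <= 1.
  by rewrite (le_trans (rnormM _ _))// mulr_ile1 ?rnorm_ge0.
have [Z [sZ _ ZZ _]] := sqrt_one_minus sNN NN1.
have ZNx x : rnorm (Z x) ^+ 2 = rnorm x ^+ 2 - rnorm (N x) ^+ 2.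
  apply: complexI; rewrite rmorphB/= !rnorm_sqr_selfadjoint// rnorm_sqr.
  by rewrite -mulopE ZZ addopE oppopE innerDl innerNl.
have Z1 x : rnorm (Z x) <= rnorm x.
  rewrite -(@ler_pXn2r _ 2) ?nnegrE ?rnorm_ge0// ZNx.
  by have := rnorm_ge0 (N x); nra.
have sZn n : adjoint (Z ^+ n) = Z ^+ n.
  elim: n => [|n IH]; first by rewrite expr0 adjoint1.
  by rewrite {1}exprS adjointM sZ IH exprSr.
have Zn1 n x : rnorm ((Z ^+ n) x) <= rnorm x.
  elim: n => [|n IH]; first by rewrite expr0.
  by rewrite exprS mulopE (le_trans (Z1 _)).
have Zinner n m k x : (n + m = k + k)%N ->
    inner ((Z ^+ n) x) ((Z ^+ m) x) = (rnorm ((Z ^+ k) x) ^+ 2)%:C%C.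
  move=> nm; rewrite rnorm_sqr_selfadjoint// -mulopE -exprD -nm addnC exprD.
  by rewrite mulopE [in RHS]adjointE sZn.
pose Y n := Z ^+ (n + n).
have [||F FY] := @pointwise_limit _ _ Y 1.
- by move=> n; apply: rnorm_bop_le => // x; rewrite mul1r Zn1.
- move=> x; apply: hilbert_complete => d d0.
  pose a n := rnorm ((Z ^+ n) x) ^+ 2.
  have a_dec n m : (n <= m)%N -> a m <= a n.
    move=> /subnK <-; rewrite /a exprD mulopE.
    by rewrite ler_pXn2r ?nnegrE ?rnorm_ge0// Zn1.
  pose s := [set a n | n in [set: nat]].
  have s_inf : has_inf s.
    by split; [exists (a 0%N), 0%N | exists 0 => _ [n _ <-]; rewrite exprn_ge0 ?rnorm_ge0].
  have [_ [n _ <-] an] := inf_adherent (exprn_gt0 2 d0) s_inf.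
  have inf_a k : inf s <= a k by apply: ge_inf; [case: s_inf|exists k].
  exists n => m nm; rewrite -(@ler_pXn2r _ 2) ?nnegrE ?rnorm_ge0 ?ltW//.
  have Ynm : inner (Y m x) (Y n x) = (a (n + m)%N)%:C%C.
    by apply: Zinner; rewrite addnACA addnC.
  rewrite (rnorm_sqrB Ynm) -!/(a _).
  have h1 : a (m + m)%N <= a (n + m)%N by apply: a_dec; rewrite leq_add2r.
  have h2 : a (n + n)%N <= a n by apply: a_dec; rewrite leq_addr.
  have := inf_a (n + m)%N; move: an; lra.
have ZZF_small x d : 0 < d -> rnorm (Z (Z (F x)) - F x) <= 2 * d.
  move=> d0; have [n nd] := (cvg_rnormP _ _).1 (FY x) d d0.
  rewrite -(subrKA (Y n.+1 x)) mulr_natl mulr2n (le_trans (rnormD _ _))// lerD//.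
    rewrite /Y addSn addnS !exprS !mulopE -/(Y n) -!opN -!opD.
    by rewrite (le_trans (Z1 _))// (le_trans (Z1 _))// opN rnorm_distC nd.
  by rewrite nd.
have ZZF x : Z (Z (F x)) = F x.
  apply/eqP; rewrite -subr_eq0; apply/eqP; apply: rnorm_arbitrarily_small.
  move=> d d0; have := ZZF_small x _ (divr_gt0 d0 (ltr0n _ 2)).
  by rewrite mulrC divfK ?pnatr_eq0.
have NF x : N (F x) = 0.
  apply: inner_eq0; rewrite -{2}sN -adjointE -mulopE.
  have -> : N * N = 1 - Z * Z by rewrite ZZ opprB addrC subrK.
  by rewrite addopE oppopE mulopE ZZF subrr inner0l.
have FN x : N x = 0 -> F x = x.
  move=> Nx; have ZZx : Z (Z x) = x.
    by rewrite -mulopE ZZ addopE oppopE mulopE Nx op0 oneopE subr0.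
  have Yx n : Y n x = x.
    elim: n => [|n]; first by rewrite /Y expr0.
    by rewrite /Y addSn addnS !exprS !mulopE -/(Y n) => ->.
  apply/eqP; rewrite -subr_eq0; apply/eqP; apply: rnorm_arbitrarily_small.
  move=> d d0; have [n nd] := (cvg_rnormP _ _).1 (FY x) d d0.
  by have := nd n (leqnn n); rewrite Yx rnorm_distC.
exists F; split=> //; last by apply: bopP => x; exact: NF.
split; last by apply: bopP => x; rewrite mulopE (FN (F x) (NF x)).
apply: bopP => y; apply/eqP; rewrite eq_sym -subr_eq0; apply/eqP.
(* the strong limit of self-adjoint operators is self-adjoint: [w] is tested
   against itself *)
set w := adjoint F y - F y; apply: rnorm_eq0; apply/eqP.
rewrite -sqrf_eq0 eq_le sqr_ge0 andbT; apply/ler_addgt0Pr => d d0.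
have c0 : 0 < rnorm y + rnorm w + 1 by rewrite ltr_wpDl ?addr_ge0 ?rnorm_ge0.
have e0 := divr_gt0 d0 c0; set e := d / _ in e0.
have [n nd] := (cvg_rnormP _ _).1 (FY w) e e0.
have [m md] := (cvg_rnormP _ _).1 (FY y) e e0.
have h1 := nd _ (leq_maxl n m); have h2 := md _ (leq_maxr n m).
have wE : inner w w = inner (- (Y (maxn n m) w - F w)) y
    + inner w (Y (maxn n m) y - F y).
  have -> : inner w w = inner (F w) y - inner w (F y).
    by rewrite {2}/w innerBr -adjointE.
  rewrite innerNl (innerBl (Y _ w)) (innerBr (Y _ y)).
  by rewrite (adjointE (Y _)) sZn; ring.
have := congr1 (@complex.Re R) wE; rewrite -rnorm_sqr raddfD/= => ->.
have h3 := Re_inner_le (- (Y (maxn n m) w - F w)) y.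
have h4 := Re_inner_le w (Y (maxn n m) y - F y).
have h5 := rnorm_ge0 y; have h6 := rnorm_ge0 w; rewrite rnormN in h3.
have h7 : e * (rnorm y + rnorm w + 1) = d by rewrite divfK// gt_eqF.
by nra.
Qed.

End AbsoluteValue.

(** * Signs of self-adjoint operators *)

Section SignAndEstimate.
Variables (R : realType) (H : hilbertType R).
Implicit Types (A B F G K N P S U : 'B(H)) (x y z : H).

(** The real inner product underlying the complex one; it is symmetric, and
    inequalities about it are within reach of real arithmetic. *)
Definition rdot x y : R := complex.Re (inner x y).

Lemma rdotDl x y z : rdot (x + y) z = rdot x z + rdot y z.
Proof. by rewrite /rdot innerDl raddfD. Qed.

Lemma rdotNl x y : rdot (- x) y = - rdot x y.
Proof. by rewrite /rdot innerNl raddfN. Qed.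

Lemma rdotC x y : rdot x y = rdot y x.
Proof. by rewrite /rdot innerC; case: (inner y x). Qed.

Lemma rdotZl (c : R) x y : rdot (c%:C%C *: x) y = c * rdot x y.
Proof.
by rewrite /rdot innerZl; case: (inner x y) => a b /=; rewrite mul0r subr0.
Qed.

Lemma rdot_selfadjoint A x y : adjoint A = A -> rdot (A x) y = rdot x (A y).
Proof. by move=> sA; rewrite /rdot adjointE sA. Qed.

Lemma rdot_sqr x : rdot x x = rnorm x ^+ 2.
Proof. by rewrite /rdot -rnorm_sqr. Qed.

Lemma rdot_positive S x : positive S -> 0 <= rdot (S x) x.
Proof. by move=> /(_ x); rewrite lecE => /andP[]. Qed.

(** [S - S ^ 2 = S (1 - S) S + (1 - S) S (1 - S)] is positive. *)
Lemma rdot_positive_ge S x : adjoint S = S -> positive S -> rnorm S <= 1 ->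
  rnorm (S x) ^+ 2 <= rdot (S x) x.
Proof.
move=> sS S0 S1; have S1' := positive_1B sS S1.
have h1 := rdot_positive (S x) S1'; have h2 := rdot_positive ((1 - S) x) S0.
have s1S : adjoint (1 - S) = 1 - S by rewrite adjointD adjointN adjoint1 sS.
rewrite -(rdot_selfadjoint _ _ s1S) -!mulopE in h2.
rewrite -rdot_selfadjoint// -!mulopE in h1.
have := addr_ge0 h1 h2; rewrite -rdotDl -addopE.
have -> : S * (1 - S) * S + (1 - S) * S * (1 - S) = S - S * S by bop_ring.
by rewrite addopE oppopE rdotDl rdotNl mulopE (rdot_selfadjoint (S x))// rdot_sqr subr_ge0.
Qed.

Lemma rnorm_projection G x : orthogonal_projection G -> rnorm (G x) <= rnorm x.
Proof.
move=> [sG GG]; have [->|/eqP x0] := pselect (rnorm (G x) = 0).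
  exact: rnorm_ge0.
have {}x0 : 0 < rnorm (G x) by rewrite lt_neqAle eq_sym x0 rnorm_ge0.
rewrite -(ler_pM2l x0) -expr2 -rdot_sqr -(rdot_selfadjoint (G x) x (esym sG)).
by rewrite -mulopE -GG; exact: Re_inner_le.
Qed.

(** A vector on which [A] almost attains its norm [l] is an approximate
    eigenvector of [A ^ 2]:
    [`|A ^ 2 x - l ^ 2 x| ^ 2 <= l ^ 2 (l ^ 2 - `|A x| ^ 2)]. *)
Lemma approximate_eigenvector A (r : R) : adjoint A = A -> rnorm A <= 1 ->
  0 < rnorm A -> 0 < r -> exists x,
  [/\ rnorm x <= 1, rnorm A / 2 <= rnorm (A x) &
      rnorm (A (A x) - (rnorm A ^+ 2)%:C%C *: x) <= r].
Proof.
move=> sA A1; set l := rnorm A => l0 r0.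
pose m := Num.min (l / 2) (r ^+ 2 / 2).
have m0 : 0 < m by rewrite lt_min !divr_gt0// exprn_gt0.
have ml : m <= l / 2 by rewrite ge_min lexx.
have mr : m <= r ^+ 2 / 2 by rewrite ge_min lexx orbT.
have [x x1 xm] : exists2 x, rnorm x <= 1 & l - m <= rnorm (A x).
  apply: contrapT => /forall2NP nx.
  suff : l <= l - m by lra.
  apply: opnorm_le => x; rewrite !rnormE !lecR => x1.
  by have [//|/negP] := nx x; rewrite -ltNge => /ltW.
have Ax : rnorm (A x) <= l * rnorm x := rnorm_bop A x.
have AAx : rnorm (A (A x)) <= l * rnorm (A x) := rnorm_bop A (A x).
exists x; split=> //; first by lra.
rewrite -(@ler_pXn2r _ 2) ?nnegrE ?rnorm_ge0 ?(ltW r0)//.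
have c : inner (A (A x)) ((l ^+ 2)%:C%C *: x)
    = (l ^+ 2 * rnorm (A x) ^+ 2)%:C%C.
  rewrite innerZr (rmorphM _ (l ^+ 2))/= rnorm_sqr_selfadjoint//.
  congr (_ * _).
  by apply/CrealP/complex_realP; eexists.
rewrite (rnorm_sqrB c) rnormZ ?sqr_ge0//.
have := rnorm_ge0 x; have := rnorm_ge0 (A x); have := rnorm_ge0 (A (A x)).
move: x1 xm Ax AAx; set u := rnorm x; set v := rnorm (A x).
set w := rnorm _ => x1 xm Ax AAx w0 v0 u0.
have h1 : w ^+ 2 <= l ^+ 2 * v ^+ 2.
  by rewrite -exprMn ler_pXn2r ?nnegrE// mulr_ge0// ltW.
have h2 : (l - m) ^+ 2 <= v ^+ 2.
  by rewrite ler_pXn2r ?nnegrE//; lra.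
have h3 : (l ^+ 2 * u) ^+ 2 <= l ^+ 2 * l ^+ 2.
  have : 0 <= l ^+ 2 * l ^+ 2 * (1 - u ^+ 2).
    by apply: mulr_ge0; rewrite ?subr_ge0 ?expr_le1// -expr2 sqr_ge0.
  by lra.
have h4 : l ^+ 2 * (l ^+ 2 - v ^+ 2) <= 2 * m.
  have : l ^+ 2 <= 1 by rewrite expr_le1// ltW.
  have := sqr_ge0 l; have : l ^+ 2 - v ^+ 2 <= 2 * m by nra.
  by nra.
by lra.
Qed.

(** If [A S + S A] vanishes on the range of [G], then the compression [a] of [A]
    satisfies [a S = - S a] there, and an eigenvector [x] of [a ^ 2] with
    eigenvalue [l ^ 2 > 0] satisfies [l ^ 2 <S x, x> + <S a x, a x> = 0].  As
    [S >= 0] this gives [S x = 0]; from [S ^ 2 = A ^ 4] one gets [A x = 0],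
    contradicting [a ^ 2 x <> 0].  The estimate follows this argument with an
    approximate eigenvector: it yields [l ^ 2 `|S y| ^ 2 <= 2 e] and
    [(l / 2) ^ 4 <= `|A y| ^ 4 <= `|S y| ^ 2 + e] for [y = G x]. *)
Lemma compression_small A G S (e : R) :
  adjoint A = A -> rnorm A <= 1 -> orthogonal_projection G ->
  adjoint S = S -> positive S -> rnorm S <= 1 -> G * S = S * G -> 0 < e ->
  rnorm (G * (A * S + S * A) * G) <= e ->
  rnorm (S * S - A * A * (A * A)) <= e ->
  rnorm (G * A * G) ^+ 6 <= 48 * e.
Proof.
move=> sA A1 pG sS S0 S1 GS e0 ASe SAe; have [sG GG] := pG.
set a := G * A * G; pose p := S * G.
have sa : adjoint a = a by rewrite /a !adjointM sA -sG mulrA.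
have [->|/eqP a0] := pselect (rnorm a = 0); first by rewrite expr0n mulr_ge0// ltW.
have {}a0 : 0 < rnorm a by rewrite lt_neqAle eq_sym a0 rnorm_ge0.
have G1 : rnorm G <= 1.
  by apply: rnorm_bop_le => // x; rewrite mul1r rnorm_projection.
have a1 : rnorm a <= 1.
  rewrite /a (le_trans (rnormM _ _))// mulr_ile1 ?rnorm_ge0//.
  by rewrite (le_trans (rnormM _ _))// mulr_ile1 ?rnorm_ge0.
have [x [x1 ax]] := approximate_eigenvector sa a1 a0 e0.
set l := rnorm a in a0 a1 ax *; set w := a (a x) - _ => we.
have pdot y : rdot (p y) y = rdot (S (G y)) (G y).
  by rewrite -rdot_selfadjoint// /p {1}GG mulrA -GS !mulopE.
have ape : a * p + p * a = G * (A * S + S * A) * G.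
  have -> : a * p = G * A * (G * S * G) by rewrite /a /p !mulrA.
  have -> : p * a = S * (G * G) * A * G by rewrite /a /p !mulrA.
  have -> : G * S * G = S * G by rewrite GS -mulrA -GG.
  by rewrite -GG -{2}GS; bop_ring.
pose y := G x.
have y1 : rnorm y <= 1 by rewrite (le_trans (rnorm_projection _ pG)).
have lS : l ^+ 2 * rnorm (S y) ^+ 2 <= 2 * e.
  have h1 : rdot (p x) (a (a x)) + rdot (p (a x)) (a x) <= e.
    rewrite -(rdot_selfadjoint (p x))// -rdotDl -!mulopE -addopE ape.
    rewrite (le_trans (Re_inner_le _ _))// -[leRHS]mulr1.
    rewrite ler_pM ?rnorm_ge0//.
      rewrite (le_trans (rnorm_bop _ _))// -[leRHS]mulr1.
      by rewrite ler_pM ?rnorm_ge0.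
    by rewrite (le_trans (rnorm_bop _ _))// mulr_ile1 ?rnorm_ge0.
  have h2 : rdot (p x) (a (a x)) = l ^+ 2 * rdot (S y) y - rdot (- w) (p x).
    have -> : a (a x) = w + (l ^+ 2)%:C%C *: x by rewrite subrK.
    by rewrite rdotC rdotDl rdotZl (rdotC x) pdot rdotNl opprK addrC.
  have h3 : 0 <= rdot (p (a x)) (a x) by rewrite pdot rdot_positive.
  have h4 := Re_inner_le (- w) (p x); rewrite rnormN -/(rdot _ _) in h4.
  have h5 : rnorm (p x) <= 1.
    rewrite mulopE (le_trans (rnorm_bop _ _))// mulr_ile1 ?rnorm_ge0//.
  have h6 := rdot_positive_ge y sS S0 S1.
  have h7 : rnorm w * rnorm (p x) <= e.
    by rewrite -[leRHS]mulr1 ler_pM ?rnorm_ge0.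
  have h8 : l ^+ 2 * rnorm (S y) ^+ 2 <= l ^+ 2 * rdot (S y) y.
    by rewrite ler_wpM2l// sqr_ge0.
  by lra.
have AS : rnorm (A (A y)) ^+ 2 <= rnorm (S y) ^+ 2 + e.
  have h1 := Re_inner_le (- ((S * S - A * A * (A * A)) y)) y.
  rewrite -/(rdot _ _) rdotNl rnormN addopE oppopE rdotDl rdotNl !mulopE in h1.
  have h2 : rdot (S (S y)) y = rnorm (S y) ^+ 2.
    by rewrite rdot_selfadjoint// rdot_sqr.
  have h3 : rdot (A (A (A (A y)))) y = rnorm (A (A y)) ^+ 2.
    by rewrite (rdot_selfadjoint (A _))// (rdot_selfadjoint (A _))// rdot_sqr.
  rewrite h2 h3 in h1.
  have h4 : rnorm (S (S y) - A (A (A (A y)))) * rnorm y <= e.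
    rewrite -[leRHS]mulr1 ler_pM ?rnorm_ge0//.
    rewrite -[leRHS]mulr1; apply: le_trans (rnorm_bop (S * S - A * A * (A * A)) y) _.
    by rewrite ler_pM ?rnorm_ge0.
  by lra.
have AA : rnorm (A y) ^+ 2 <= rnorm (A (A y)).
  rewrite -rdot_sqr -rdot_selfadjoint// (le_trans (Re_inner_le _ _))//.
  by rewrite ler_piMr ?rnorm_ge0.
have aA : rnorm (a x) <= rnorm (A y) by rewrite /a !mulopE rnorm_projection.
have h1 : (l / 2) ^+ 4 <= rnorm (A (A y)) ^+ 2.
  rewrite (exprM _ 2 2) ler_pXn2r ?nnegrE ?sqr_ge0 ?rnorm_ge0//.
  apply: le_trans AA; rewrite ler_pXn2r ?nnegrE ?rnorm_ge0 ?divr_ge0 ?(ltW a0)//.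
  exact: le_trans aA.
have l1 : l ^+ 2 <= 1 by rewrite expr_le1// ltW.
have h2 : l ^+ 2 * (l / 2) ^+ 4 <= l ^+ 2 * (rnorm (S y) ^+ 2 + e).
  by rewrite ler_wpM2l ?sqr_ge0// (le_trans h1).
have -> : l ^+ 6 = 16 * (l ^+ 2 * (l / 2) ^+ 4) by field.
by have := sqr_ge0 l; nra.
Qed.

(** [S] is [`|K|] and [F] projects onto the kernel of [S + K].  Since
    [(S + K) (S - K) = 0], the range of [S - K] lies in that kernel, so [S - K]
    vanishes on its orthogonal; thus [1 - 2 F] is a sign of [K]. *)
Lemma sign_decomposition K : adjoint K = K -> rnorm K <= 1 ->
  exists F S, [/\ orthogonal_projection F,
    [/\ adjoint S = S, positive S, rnorm S <= 1 & S * S = K * K],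
    F * S = S * F, K * F = - (S * F) & K * (1 - F) = S * (1 - F)].
Proof.
move=> sK K1; have [S [sS S0 SS Scomm]] := absolute_value sK K1.
have S1 : rnorm S <= 1.
  apply: rnorm_bop_le => // x.
  by rewrite (eq_rnorm_sqr x sS sK SS) (le_trans (rnorm_bop _ _))// ler_wpM2r ?rnorm_ge0.
have SK : S * K = K * S.
  apply/eqP; rewrite -subr_eq0; apply/eqP; apply: rnorm_arbitrarily_small => d d0.
  have [n nK] := Scomm d d0; rewrite (le_trans (nK K))//.
  by rewrite mulrA subrr rnorm0 mulr0 addr0 ler_piMr// ltW.
pose N := 2^-1 *: (S + K); pose M := S - K.
have sN : adjoint N = N.
  by rewrite adjointZ adjointD sS sK fmorphV rmorph_nat.
have N1 : rnorm N <= 1.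
  by rewrite rnormVn ler_pdivrMl// mulr1 (le_trans (rnormD _ _))// lerD.
have sM : adjoint M = M by rewrite adjointD adjointN sS sK.
have NM : N * M = 0.
  have -> : N * M = 2^-1 *: (S * S - K * K - (S * K - K * S)).
    by rewrite /N /M; bop_ring.
  by rewrite SS SK !subrr ?subr0 scaler0.
have [F [pF NF FN]] := kernel_projection sN N1; have [sF FF] := pF.
have FM : F * M = M.
  by apply: bopP => x; rewrite mulopE FN// -mulopE NM.
have MF : M * F = M by have := congr1 (@adjoint R H) FM; rewrite adjointM sM -sF.
have FN0 : F * N = 0.
  have := congr1 (@adjoint R H) NF; rewrite adjointM sN -sF => ->.
  by rewrite -(scale0r (1 : 'B(H))) adjointZ rmorph0 !scale0r.
have SE : S = N + 2^-1 *: M by rewrite /N /M; bop_ring.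
have KE : K = N - 2^-1 *: M by rewrite /N /M; bop_ring.
have SF : S * F = 2^-1 *: M.
  rewrite SE mulrDl NF add0r -[in RHS]MF; bop_ring.
have KF : K * F = - (2^-1 *: M).
  rewrite KE mulrDl NF add0r -[in RHS]MF; bop_ring.
exists F, S; split=> //.
- rewrite SF SE mulrDr FN0 add0r -[in RHS]FM; bop_ring.
- by rewrite SF.
- by rewrite !mulrBr SF KF !mulr1 SE KE; bop_ring.
Qed.

End SignAndEstimate.

(** * Almost exchanging the spectral parts of an operator *)

Section AlmostExchanged.
Variables (R : realType) (H : hilbertType R).
Implicit Types (A B C D F G K N P Q S T U V p q : 'B(H)) (x y z : H).

(** The square root and the absolute value satisfy the hypothesis, so they
    commute with whatever commutes with the operator that they come from. *)
Lemma commute_of_almost B S :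
  (forall e, 0 < e -> exists n : nat, forall U,
     rnorm (S * U - U * S) <= e * rnorm U + n%:R * rnorm (B * U - U * B)) ->
  forall U, B * U = U * B -> S * U = U * S.
Proof.
move=> SB U BU; apply/eqP; rewrite -subr_eq0; apply/eqP.
apply: rnorm_arbitrarily_small => d d0.
have c0 : 0 < rnorm U + 1 by rewrite ltr_wpDl ?rnorm_ge0.
have [n nU] := SB _ (divr_gt0 d0 c0); rewrite (le_trans (nU U))//.
rewrite BU subrr rnorm0 mulr0 addr0 mulrAC ler_pdivrMr// ler_pM2l// lerDl.
exact: ler01.
Qed.

Lemma rnormM_le A B (a b : R) : rnorm A <= a -> rnorm B <= b ->
  rnorm (A * B) <= a * b.
Proof. by move=> Aa Bb; rewrite (le_trans (rnormM _ _))// ler_pM ?rnorm_ge0. Qed.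

Lemma rnormM_le1l A B (b : R) : rnorm A <= 1 -> rnorm B <= b -> rnorm (A * B) <= b.
Proof. by move=> Aa Bb; rewrite -[b]mul1r rnormM_le. Qed.

Lemma rnormM_le1r A B (a : R) : rnorm A <= a -> rnorm B <= 1 -> rnorm (A * B) <= a.
Proof. by move=> Aa Bb; rewrite -[a]mulr1 rnormM_le. Qed.

Lemma rnorm_unitary U : unitary U -> rnorm U <= 1.
Proof.
move=> [UU _]; apply: rnorm_bop_le => // x; rewrite mul1r.
rewrite -(@ler_pXn2r _ 2) ?nnegrE ?rnorm_ge0//.
by rewrite -!rdot_sqr /rdot adjointE -mulopE UU oneopE.
Qed.

Lemma rnorm_unitary_adjoint U : unitary U -> rnorm (adjoint U) <= 1.
Proof. by move=> uU; rewrite (le_trans (rnorm_adjoint _))// rnorm_unitary. Qed.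

Lemma swap_anticommutator p q U V : p * q = 0 -> q * p = 0 ->
  (p - q) * (p * U * q + q * V * p) + (p * U * q + q * V * p) * (p - q)
  = p * (p * U - U * q) * q + q * (V * p - q * V) * p.
Proof.
move=> pq qp.
have -> : (p - q) * (p * U * q + q * V * p) + (p * U * q + q * V * p) * (p - q)
  = p * (p * U - U * q) * q + q * (V * p - q * V) * p + p * q * V * p
    - q * p * U * q + p * U * (q * p) - q * V * (p * q) by bop_ring.
by rewrite pq qp !mul0r !mulr0 !(addr0, subr0).
Qed.

(** Moving [U] and [V] across [q] with [U q = p U - D] and [q V = V p - E] turns
    [p U q q V p] into [p ^ 4] and [q V p p U q] into [q ^ 4], up to terms that
    contain [D] or [E]. *)
Lemma swap_square p q U V :
  p * q = 0 -> q * p = 0 -> U * V = 1 -> V * U = 1 ->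
  (p * U * q + q * V * p) * (p * U * q + q * V * p)
    - (p - q) * (p - q) * ((p - q) * (p - q))
  = q * V * p * (p * U - U * q) * q + q * V * (p * U - U * q) * q * q
    - (p * (p * U - U * q) * V * p * p + p * U * q * (V * p - q * V) * p).
Proof.
move=> pq qp UV VU.
have -> : (p - q) * (p - q) = p * p + q * q.
  have -> : (p - q) * (p - q) = p * p + q * q - p * q - q * p by bop_ring.
  by rewrite pq qp !subr0.
have -> : (p * p + q * q) * (p * p + q * q)
    = p * p * p * p + q * q * q * q + p * (p * q) * q + q * (q * p) * p.
  by bop_ring.
have -> : (p * U * q + q * V * p) * (p * U * q + q * V * p)
  = p * U * (q * p) * U * q + q * V * (p * q) * V * p
  + p * p * (U * V) * p * p + q * (V * U) * q * q * q
  + (q * V * p * (p * U - U * q) * q + q * V * (p * U - U * q) * q * q)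
  - (p * (p * U - U * q) * V * p * p + p * U * q * (V * p - q * V) * p).
  by bop_ring.
rewrite pq qp UV VU !mulr1 !mulr0 !mul0r !addr0 !add0r.
bop_ring.
Qed.

(** With [p] and [q] the positive and negative parts of [A], the operator is
    [p U q + q U^* p]; as [U] almost exchanges [p] and [q], it almost
    anticommutes with [A = p - q] and its square is almost
    [p ^ 4 + q ^ 4 = A ^ 4]. *)
Lemma almost_anticommuting A P U (d : R) :
  adjoint A = A -> adjoint P = P -> P * P = A * A -> P * A = A * P ->
  rnorm A <= 2^-1 -> rnorm P <= 2^-1 -> unitary U ->
  rnorm (A * U + U * A) <= d -> rnorm (P * U - U * P) <= d ->
  exists K, [/\ adjoint K = K, rnorm K <= 1, rnorm (A * K + K * A) <= 4 * d &
    rnorm (K * K - A * A * (A * A)) <= 4 * d].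
Proof.
move=> sA sP PP PA A1 P1 uU AU PU; have [VU UV] := uU.
have U1 := rnorm_unitary uU; have V1 := rnorm_unitary_adjoint uU.
set V := adjoint U in VU UV V1.
pose p : 'B(H) := 2^-1 *: (P + A); pose q : 'B(H) := 2^-1 *: (P - A).
have half : (2^-1)^* = 2^-1 :> R[i] by rewrite fmorphV rmorph_nat.
have sp : adjoint p = p by rewrite adjointZ adjointD sP sA half.
have sq : adjoint q = q by rewrite adjointZ adjointD adjointN sP sA half.
have p2 : rnorm p <= 2^-1.
  by rewrite rnormVn; have := rnormD P A; lra.
have q2 : rnorm q <= 2^-1.
  by rewrite rnormVn; have := rnormB P A; lra.
have p1 : rnorm p <= 1 by lra.
have q1 : rnorm q <= 1 by lra.
have pq : p * q = 0.
  have -> : p * q = 4^-1 *: (P * P - A * A - (P * A - A * P)).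
    by rewrite /p /q; bop_ring.
  by rewrite PP PA !subrr ?subr0 scaler0.
have qp : q * p = 0.
  have -> : q * p = 4^-1 *: (P * P - A * A + (P * A - A * P)).
    by rewrite /p /q; bop_ring.
  by rewrite PP PA !subrr ?addr0 scaler0.
have AE : A = p - q by rewrite /p /q; bop_ring.
pose D : 'B(H) := p * U - U * q; pose E : 'B(H) := V * p - q * V.
have Dd : rnorm D <= d.
  have -> : D = 2^-1 *: ((P * U - U * P) + (A * U + U * A)).
    by rewrite /D /p /q; bop_ring.
  by rewrite rnormVn; have := rnormD (P * U - U * P) (A * U + U * A); lra.
have Ed : rnorm E <= d.
  have -> : E = adjoint D by rewrite adjointD adjointN !adjointM sp sq.
  exact: le_trans (rnorm_adjoint _) Dd.
exists (p * U * q + q * V * p); split.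
- by rewrite adjointD !adjointM sp sq adjointK addrC !mulrA.
- rewrite (le_trans (rnormD _ _))// [leRHS](_ : 1 = 2^-1 + 2^-1); last by field.
  by apply: lerD; (apply: rnormM_le1r; [apply: rnormM_le1r|]).
- rewrite AE (swap_anticommutator U V pq qp) -/D -/E.
  have h1 : rnorm (p * D * q) <= d by apply: rnormM_le1r => //; apply: rnormM_le1l.
  have h2 : rnorm (q * E * p) <= d by apply: rnormM_le1r => //; apply: rnormM_le1l.
  by have := rnormD (p * D * q) (q * E * p); have := rnorm_ge0 D; lra.
rewrite AE (swap_square pq qp UV VU) -/D -/E.
have qV1 := rnormM_le1r q1 V1; have pU1 := rnormM_le1r p1 U1.
have h1 := rnormM_le1r (rnormM_le1l (rnormM_le1r qV1 p1) Dd) q1.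
have h2 := rnormM_le1r (rnormM_le1r (rnormM_le1l qV1 Dd) q1) q1.
have h3 := rnormM_le1r (rnormM_le1r (rnormM_le1r (rnormM_le1l p1 Dd) V1) p1) p1.
have h4 := rnormM_le1r (rnormM_le1l (rnormM_le1r pU1 q1) Ed) p1.
have h5 := rnormB (q * V * p * D * q + q * V * D * q * q)
  (p * D * V * p * p + p * U * q * E * p).
have h6 := rnormD (q * V * p * D * q) (q * V * D * q * q).
have h7 := rnormD (p * D * V * p * p) (p * U * q * E * p).
by lra.
Qed.


(** The sign of the almost anticommuting operator splits the space in two parts
    that [A] almost exchanges. *)
Lemma almost_exchanged A (e : R) : adjoint A = A -> rnorm A <= 2^-1 ->
  (forall d, 0 < d -> exists U, unitary U /\ rnorm (A * U + U * A) <= d) ->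
  0 < e -> exists F, [/\ orthogonal_projection F, rnorm (F * A * F) <= e &
    rnorm ((1 - F) * A * (1 - F)) <= e].
Proof.
move=> sA A2 AU e0; have A1 : rnorm A <= 1 by lra.
have [P [sP P0 PP Palmost]] := absolute_value sA A1.
have PA : P * A = A * P by apply: (commute_of_almost Palmost); rewrite mulrA.
have P2 : rnorm P <= 2^-1.
  apply: rnorm_bop_le => [x|]; last by rewrite invr_ge0.
  rewrite (eq_rnorm_sqr x sP sA PP) (le_trans (rnorm_bop _ _))//.
  by rewrite ler_wpM2r ?rnorm_ge0.
(* the error [t] is what [compression_small] turns into [e]; a fourth of it
   is allowed for [A U + U A] and for the commutator of [`|A|] with [U] *)
pose t := e ^+ 6 / 48; have t0 : 0 < t by rewrite divr_gt0 ?exprn_gt0.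
have d0 : 0 < t / 4 by rewrite divr_gt0.
have [n nU] := Palmost _ (divr_gt0 d0 (ltr0n _ 2)).
have n0 : 0 < 2 * (n%:R + 1) :> R by rewrite mulr_gt0// ltr_wpDl.
have [U [uU dU]] := AU _ (divr_gt0 d0 n0).
have U1 := rnorm_unitary uU; set d := t / 4 in d0 nU dU.
have h1 : d / (2 * (n%:R + 1)) <= d.
  by rewrite ler_pdivrMr// ler_peMr ?ltW//; have := ler0n R n; lra.
have h2 : n%:R * (d / (2 * (n%:R + 1))) <= d / 2.
  rewrite mulrA ler_pdivrMr// (_ : d / 2 * _ = d * n%:R + d); last by field.
  by rewrite mulrC lerDl ltW.
have PU : rnorm (P * U - U * P) <= d.
  rewrite (le_trans (nU U))//.
  have h3 : rnorm (A * A * U - U * (A * A)) <= d / (2 * (n%:R + 1)).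
    have -> : A * A * U - U * (A * A) = A * (A * U + U * A) - (A * U + U * A) * A.
      by bop_ring.
    have := rnormB (A * (A * U + U * A)) ((A * U + U * A) * A).
    by have := rnormM_le A2 dU; have := rnormM_le dU A2; lra.
  have h4 := le_trans (ler_wpM2l (ler0n R n) h3) h2.
  have h5 : d / 2 * rnorm U <= d / 2 by rewrite ler_piMr// divr_ge0// ltW.
  by move: h4 h5; lra.
have [K [sK K1 AK KA]] :=
  almost_anticommuting sA sP PP PA A2 P2 uU (le_trans dU h1) PU.
have d4 : 4 * d = t by rewrite /d; field.
rewrite d4 in AK KA.
have [F [S [pF [sS S0 S1 SS] FS KF KF']]] := sign_decomposition sK K1.
have [sF FF] := pF.
have pF' : orthogonal_projection (1 - F).
  split; first by rewrite adjointD adjointN adjoint1 -sF.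
  have -> : (1 - F) * (1 - F) = 1 - F - F + F * F by bop_ring.
  by rewrite -FF subrK.
have F1 G : orthogonal_projection G -> rnorm G <= 1.
  by move=> pG; apply: rnorm_bop_le => // x; rewrite mul1r rnorm_projection.
have FK : F * K = - (F * S).
  by have := congr1 (@adjoint R H) KF; rewrite adjointN !adjointM sK sS -sF.
have FK' : (1 - F) * K = (1 - F) * S.
  have := congr1 (@adjoint R H) KF'.
  by rewrite !adjointM sK sS adjointD adjointN adjoint1 -sF.
have small G : orthogonal_projection G -> G * S = S * G ->
    rnorm (G * (A * S + S * A) * G) <= t -> rnorm (G * A * G) <= e.
  move=> pG GS GAS.
  have := compression_small sA A1 pG sS S0 S1 GS t0 GAS.
  rewrite SS => /(_ KA); have -> : 48 * t = e ^+ 6 by rewrite /t; field.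
  by rewrite ler_pXn2r ?nnegrE ?rnorm_ge0// ltW.
have GXG G X : G * (A * X + X * A) * G = G * A * (X * G) + (G * X) * A * G.
  by bop_ring.
exists F; split=> //; apply: small => //.
- have -> : F * (A * S + S * A) * F = - (F * (A * K + K * A) * F).
    by rewrite !GXG KF FK; bop_ring.
  by rewrite rnormN; apply: rnormM_le1r (F1 _ pF); apply: rnormM_le1l (F1 _ pF) _.
- by rewrite mulrBl mulrBr mul1r mulr1 FS.
- rewrite GXG -FK' -KF' -GXG.
  by apply: rnormM_le1r (F1 _ pF'); apply: rnormM_le1l (F1 _ pF') _.
Qed.

End AlmostExchanged.

(** * Symmetries and commutators of projections *)

Section Symmetries.
Variables (R : realType) (H : hilbertType R).
Implicit Types (C P Q S T s t : 'B(H)).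

Lemma projection_symmetry P : orthogonal_projection P ->
  adjoint (2 *: P - 1) = 2 *: P - 1 /\ (2 *: P - 1) * (2 *: P - 1) = 1.
Proof.
move=> [sP PP]; split.
  by rewrite adjointD adjointN adjoint1 adjointZ -sP rmorph_nat.
have -> : (2 *: P - 1) * (2 *: P - 1) = 4 *: (P * P) - 4 *: P + 1 by bop_ring.
by rewrite -PP subrr add0r.
Qed.

Lemma symmetry_projection S : adjoint S = S -> S * S = 1 ->
  orthogonal_projection (2^-1 *: (1 + S)).
Proof.
move=> sS SS; split; first by rewrite adjointZ adjointD adjoint1 sS fmorphV rmorph_nat.
have -> : 2^-1 *: (1 + S) * (2^-1 *: (1 + S)) = 4^-1 *: (1 + S + S + S * S).
  by bop_ring.
by rewrite SS; bop_ring.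
Qed.

Lemma symmetry_unitary S : adjoint S = S -> S * S = 1 -> unitary S.
Proof. by move=> sS SS; split; rewrite sS. Qed.

Lemma symmetry_commutator s t : adjoint s = s -> s * s = 1 ->
  adjoint t = t -> t * t = 1 ->
  commutator_of_projections (4^-1 *: (s * t - t * s)).
Proof.
move=> ss s2 st t2; exists (2^-1 *: (1 + s)), (2^-1 *: (1 + t)); split.
- exact: symmetry_projection.
- exact: symmetry_projection.
- bop_ring.
Qed.

(** Relative to the symmetry [s] the operator [T] is off-diagonal.  With [r] the
    square root of [1 + 4 T ^ 2], the operator [t = s r + 2 s T] is a second
    symmetry, and [s t - t s = 4 T]. *)
Lemma commutator_of_anticommuting T s : adjoint T = - T -> rnorm T <= 2^-1 ->
  adjoint s = s -> s * s = 1 -> s * T = - (T * s) -> commutator_of_projections T.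
Proof.
move=> sT T2 ss s2 sTs; have Ts : T * s = - (s * T) by rewrite sTs opprK.
pose B : 'B(H) := - (4 *: (T * T)).
have sB : adjoint B = B.
  by rewrite adjointN adjointZ adjointM sT mulrNN rmorph_nat.
have B1 : rnorm B <= 1.
  have := rnormM_le T2 T2; rewrite /B rnormN.
  rewrite (_ : 4 *: (T * T) = (4%:R : R)%:C%C *: (T * T)).
    by rewrite rnormZ//; lra.
  by rewrite rmorph_nat.
(* [B = - 4 T ^ 2], so [r] is the square root of [1 + 4 T ^ 2] *)
have [r [sr _ rr ralmost]] := sqrt_one_minus sB B1.
have rT : r * T = T * r.
  by apply: (commute_of_almost ralmost); rewrite /B; bop_ring.
have rs : r * s = s * r.
  apply: (commute_of_almost ralmost).
  have -> : B * s = - (4 *: (T * (T * s))) by rewrite /B; bop_ring.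
  have -> : T * (T * s) = s * T * T by rewrite Ts mulrN mulrA Ts mulNr opprK.
  by rewrite /B; bop_ring.
pose t : 'B(H) := s * r + 2 *: (s * T).
have st : adjoint t = t.
  rewrite /t adjointD adjointZ !adjointM ss sr rs sT rmorph_nat.
  by rewrite sTs mulNr.
have t2 : t * t = 1.
  have -> : t * t = s * (r * s) * r + 2 *: (s * (r * s) * T)
      + 2 *: (s * (T * s) * r) + 4 *: (s * (T * s) * T).
    by rewrite /t; bop_ring.
  rewrite Ts rs mulrN !mulrA s2 !mul1r.
  have -> : r * r + 2 *: (r * T) + 2 *: (- T * r) + 4 *: (- T * T)
      = r * r + 2 *: (r * T - T * r) - 4 *: (T * T) by bop_ring.
  by rewrite rT subrr scaler0 addr0 rr /B opprK addrK.
have -> : T = 4^-1 *: (s * t - t * s).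
  have -> : s * t - t * s = s * s * r + 2 *: (s * s * T)
      - s * (r * s) - 2 *: (s * (T * s)) by rewrite /t; bop_ring.
  by rewrite Ts rs mulrN !mulrA s2 !mul1r; bop_ring.
exact: symmetry_commutator.
Qed.

Lemma commutator_skew C : commutator_of_projections C -> adjoint C = - C.
Proof.
move=> [P [Q [[sP _] [sQ _] ->]]].
by rewrite adjointD adjointN !adjointM -sP -sQ opprB.
Qed.

Lemma commutator_symmetries C : commutator_of_projections C -> exists s t,
  [/\ adjoint s = s /\ s * s = 1, adjoint t = t /\ t * t = 1 &
      C = 4^-1 *: (s * t - t * s)].
Proof.
move=> [P [Q [pP pQ ->]]]; exists (2 *: P - 1), (2 *: Q - 1); split.
- exact: projection_symmetry.
- exact: projection_symmetry.
- bop_ring.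
Qed.

Lemma commutator_rnorm C : commutator_of_projections C -> rnorm C <= 2^-1.
Proof.
move=> /commutator_symmetries[s [t [[ss s2] [st t2] ->]]].
have s1 := rnorm_unitary (symmetry_unitary ss s2).
have t1 := rnorm_unitary (symmetry_unitary st t2).
rewrite rnormVn; have := rnormB (s * t) (t * s).
by have := rnormM_le1l s1 t1; have := rnormM_le1l t1 s1; lra.
Qed.

Lemma commutator_anticommutes C : commutator_of_projections C ->
  exists s, [/\ adjoint s = s, s * s = 1 & s * C * s = - C].
Proof.
move=> /commutator_symmetries[s [t [[ss s2] [st t2] ->]]]; exists s; split=> //.
have -> : s * (4^-1 *: (s * t - t * s)) * s
    = 4^-1 *: (s * s * t * s - s * t * (s * s)) by bop_ring.
by rewrite s2 mul1r mulr1; bop_ring.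
Qed.

End Symmetries.

(** * Limits of commutators of projections *)

Section Limits.
Variables (R : realType) (H : hilbertType R).
Implicit Types (A C F T U s : 'B(H)).

Lemma rnorm_le_half T : (`|T| <= 2^-1) = (rnorm T <= 2^-1).
Proof.
rewrite rnormE -lecR; congr (_ <= _).
by rewrite fmorphV rmorph_nat.
Qed.

Lemma limit_of_commutatorsP T : limit_of_projection_commutators T <->
  forall e : R, 0 < e ->
    exists C, commutator_of_projections C /\ rnorm (C - T) <= e.
Proof.
split=> [[C [cC /cvg_rnormP CT]] e /CT[n nC]|].
  by exists (C n); split; [exact: cC | exact: nC].
move=> CT; have [|C cC] := @choice nat 'B(H) (fun n C =>
    commutator_of_projections C /\ rnorm (C - T) <= n.+1%:R^-1).
  by move=> n; apply: CT; rewrite invr_gt0.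
exists C; split=> [n|]; first by case: (cC n).
apply/cvg_rnormP => e e0; have [N Ne] := ltr_add_invr e0.
exists N => n Nn; have [_ /le_trans->//] := cC n.
move: Ne; rewrite add0r => /ltW; apply: le_trans.
by rewrite lef_pV2 ?posrE ?ltr0n// ler_nat.
Qed.

Lemma limit_of_commutators_skew T : limit_of_projection_commutators T ->
  adjoint T = - T.
Proof.
move=> /limit_of_commutatorsP CT; apply/eqP; rewrite -addr_eq0; apply/eqP.
apply: rnorm_arbitrarily_small => e e0.
have [C [cC CTe]] := CT _ (divr_gt0 e0 (ltr0n R 2)).
have -> : adjoint T + T = - adjoint (C - T) - (C - T).
  by rewrite adjointD adjointN (commutator_skew cC); bop_ring.
have := rnormB (- adjoint (C - T)) (C - T); rewrite rnormN.
by have := rnorm_adjoint (C - T); lra.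
Qed.

Lemma limit_of_commutators_rnorm T : limit_of_projection_commutators T ->
  rnorm T <= 2^-1.
Proof.
move=> /limit_of_commutatorsP CT; apply/ler_addgt0Pr => e /CT[C [cC CTe]].
have -> : T = C - (C - T) by rewrite opprB addrC subrK.
by rewrite (le_trans (rnormB _ _))// lerD// commutator_rnorm.
Qed.

Lemma limit_of_commutators_equivalent T : limit_of_projection_commutators T ->
  approx_unitarily_equivalent T (adjoint T).
Proof.
move=> lT; have sT := limit_of_commutators_skew lT.
case: lT => C [cC /cvg_rnormP CT].
have [s sP] := choice (fun n => commutator_anticommutes (cC n)).
have us n : unitary (s n) by have [ss s2 _] := sP n; exact: symmetry_unitary.
exists s; split=> //; apply/cvg_rnormP => e e0.
have [N NC] := CT _ (divr_gt0 e0 (ltr0n _ 2)); exists N => n /NC Cn.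
have [ss s2 sC] := sP n; have s1 := rnorm_unitary (us n); rewrite sT ss.
have -> : s n * T * s n - - T = (s n * C n * s n + C n)
    - s n * (C n - T) * s n - (C n - T) by bop_ring.
rewrite sC addNr sub0r (le_trans (rnormB _ _))// rnormN.
by have := rnormM_le1r (rnormM_le1l s1 Cn) s1; lra.
Qed.

(** For a symmetry [s], the part of [T] that exchanges the eigenspaces of [s]. *)
Definition offdiagonal T s : 'B(H) := 2^-1 *: (T - s * T * s).

Lemma offdiagonal_skew T s : adjoint T = - T -> adjoint s = s ->
  adjoint (offdiagonal T s) = - offdiagonal T s.
Proof.
move=> sT ss; rewrite adjointZ adjointD adjointN !adjointM ss sT.
by rewrite fmorphV rmorph_nat mulNr mulrN mulrA -scalerN opprB opprK addrC.
Qed.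

Lemma offdiagonal_rnorm T s : rnorm s <= 1 -> rnorm (offdiagonal T s) <= rnorm T.
Proof.
move=> s1; rewrite rnormVn; have := rnormB T (s * T * s).
by have := rnormM_le1r (rnormM_le1l s1 (lexx (rnorm T))) s1; lra.
Qed.

Lemma offdiagonal_anticommutes T s : s * s = 1 ->
  s * offdiagonal T s = - (offdiagonal T s * s).
Proof.
move=> s2.
have sC : s * offdiagonal T s = 2^-1 *: (s * T - s * s * T * s).
  by rewrite /offdiagonal; bop_ring.
have Cs : offdiagonal T s * s = 2^-1 *: (T * s - s * T * (s * s)).
  by rewrite /offdiagonal; bop_ring.
by rewrite sC Cs s2 mul1r mulr1 -scalerN opprB.
Qed.

(** [F] and [1 - F] are the projections onto the eigenspaces of the symmetry
    [2 F - 1]. *)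
Lemma offdiagonal_sub T F :
  offdiagonal T (2 *: F - 1) - T = - (F * T * F + (1 - F) * T * (1 - F)).
Proof. by rewrite /offdiagonal; bop_ring. Qed.

(** Replace [T] by its off-diagonal part with respect to a projection whose two
    ranges [T] almost exchanges. *)
Lemma limit_of_commutators_suff T : adjoint T = - T -> rnorm T <= 2^-1 ->
  approx_unitarily_equivalent T (adjoint T) -> limit_of_projection_commutators T.
Proof.
move=> sT T2 [U [uU /cvg_rnormP UT]]; apply/limit_of_commutatorsP => e e0.
pose A : 'B(H) := 'i *: T.
have rnormi (X : 'B(H)) : rnorm ('i *: X) = rnorm X.
  by rewrite /rnorm normrZ normCi mul1r.
have sA : adjoint A = A by rewrite adjointZ conjCi sT scaleNr scalerN opprK.
have TA : T = - ('i *: A) by rewrite /A scalerA -expr2 sqrCi scaleN1r opprK.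
have A2 : rnorm A <= 2^-1 by rewrite rnormi.
have AU d : 0 < d -> exists V, unitary V /\ rnorm (A * V + V * A) <= d.
  move=> /UT[n nU]; exists (U n); split=> //; have [_ UV] := uU n.
  have -> : A * U n + U n * A = 'i *: (T * U n + U n * T).
    by rewrite /A; bop_ring.
  rewrite rnormi; have -> : T * U n + U n * T
      = U n * (adjoint (U n) * T * U n - adjoint T).
    by rewrite sT mulrBr !mulrA UV mul1r mulrN opprK.
  by apply: rnormM_le1l; [exact: rnorm_unitary | exact: nU].
have [F [pF AF AF']] := almost_exchanged sA A2 AU (divr_gt0 e0 (ltr0n _ 2)).
have [ss s2] := projection_symmetry pF; set s : 'B(H) := 2 *: F - 1 in ss s2.
have s1 := rnorm_unitary (symmetry_unitary ss s2).
exists (offdiagonal T s); split.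
  apply: (@commutator_of_anticommuting _ _ _ s) => //.
  - exact: offdiagonal_skew.
  - by rewrite (le_trans (offdiagonal_rnorm T s1)).
  - exact: offdiagonal_anticommutes.
have XTX X : rnorm (X * T * X) = rnorm (X * A * X).
  rewrite -[RHS]rnormi -[RHS]rnormN {1}TA; congr rnorm; bop_ring.
rewrite offdiagonal_sub rnormN (le_trans (rnormD _ _))// !XTX.
by lra.
Qed.

End Limits.

Theorem theorem5p7 (R : realType) (H : hilbertType R) (T : 'B(H)) :
  limit_of_projection_commutators T <->
  [/\ adjoint T = - T, `|T| <= 2^-1 & approx_unitarily_equivalent T (adjoint T)].
Proof.
rewrite rnorm_le_half; split=> [lT|[sT T2 eT]].
  split; [exact: limit_of_commutators_skew | exact: limit_of_commutators_rnorm |].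
  exact: limit_of_commutators_equivalent.
exact: limit_of_commutators_suff.
Qed.
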